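(* For every $n$, there are an $n$-semirecursive $e$-degree $\mathbf{c}\leq\mathbf{0}''$ and a total $e$-degree $\mathbf{d}\leq\mathbf{0}''$ such that the join $\mathbf{c}\oplus\mathbf{d}$ is not $(n+1)$-semirecursive. In particular, $\mathcal{D}_{\mathbb{R}\times\mathbb{R}_<^n}\not\subseteq\mathcal{D}_{\mathbb{R}_<^{n+1}}$.
   Context: Enumeration reducibility: for $A,B\subseteq\omega$, $A\leq_e B$ iff there is a c.e. set $\Phi$ such that $n\in A\iff(\exists e)[\langle n,e\rangle\in\Phi$ and $D_e\subseteq B]$, where $(D_e)$ is a computable enumeration of all finite subsets of $\omega$. The equivalence classes of $\equiv_e$ are the $e$-degrees; the join is induced by $A\oplus B=\{2n:n\in A\}\cup\{2n+1:n\in B\}$. A set $A$ is total if $\omega\setminus A\leq_eA$; an $e$-degree is total if it contains a total set. $\mathbf{0}''$ denotes the total $e$-degree of $\emptyset''\oplus(\omega\setminus\emptyset'')$. A set $A\subseteq\omega$ is semirecursive if there is a computable $s:\omega\times\omega\to\{0,1\}$ such that whenever $\{n_0,n_1\}\cap A\neq\emptyset$, then $n_{s(n_0,n_1)}\in A$. An $e$-degree is semirecursive if it contains a semirecursive set, and $n$-semirecursive if it is the join of $n$ semirecursive $e$-degrees. $\mathbb{R}_<$ is the set of reals with the topology generated by the intervals $(q,\infty)$, $q\in\mathbb{Q}$, with subbasis enumerated by rationals, so $\mathrm{Nbase}_<(x)=\{q\in\mathbb{Q}:q<x\}$ (rationals coded by natural numbers); $\mathbb{R}$ carries the Euclidean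 topology with the standard enumeration of rational open intervals as basis. For a point in a product, the coded neighborhood filter is the $\oplus$-join of those of its coordinates. For a represented second-countable space $\mathcal{X}$, $\mathcal{D}_{\mathcal X}$ is the set of $e$-degrees of the coded neighborhood filters $\{e:x\in\beta_e\}$ of points $x\in\mathcal{X}$, where $(\beta_e)$ is the enumerated subbasis. The $\mathbb{R}_<^n$-degrees are exactly the $n$-semirecursive $e$-degrees. *)

(* Defs.v *)
From mathcomp Require Import all_boot all_order all_algebra.
From mathcomp Require Import all_classical all_reals.
From Stdlib Require Cantor.
Set Implicit Arguments.
Unset Strict Implicit.
Unset Printing Implicit Defensive.
Local Open Scope classical_set_scope.

Definition npair (x y : nat) : nat := Cantor.to_nat (x, y).
Definition nfst (k : nat) : nat := (Cantor.of_nat k).1.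
Definition nsnd (k : nat) : nat := (Cantor.of_nat k).2.

(* Programs for the partial recursive functions nat -> nat with an oracle;
   functions of several arguments take their arguments coded by [npair]. *)
Inductive code : Type :=
  | CZero | CSucc | CFst | CSnd | COracle
  | CPair of code & code
  | CComp of code & code
  | CPrec of code & code
  | CMu of code.

(* [eval A c x y] : the program c with oracle A halts on x with output y.
   [CPrec f g] is primitive recursion, h<a,0> = f a and
   h<a,m+1> = g<a,<m,h<a,m>>>; [CMu f] is unbounded search for the least n
   with f<x,n> = 0, all earlier values being defined and nonzero. *)
Fixpoint eval (A : set nat) (c : code) (x y : nat) {struct c} : Prop :=
  match c with
  | CZero => y = 0
  | CSucc => y = x.+1
  | CFst => y = nfst x
  | CSnd => y = nsnd x
  | COracle => A x /\ y = 1 \/ ~ A x /\ y = 0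
  | CPair f g => exists u v, [/\ eval A f x u, eval A g x v & y = npair u v]
  | CComp f g => exists u, eval A g x u /\ eval A f u y
  | CPrec f g =>
      (fix prec (m : nat) (z : nat) {struct m} : Prop :=
         match m with
         | 0 => eval A f (nfst x) z
         | m'.+1 => exists u,
             prec m' u /\ eval A g (npair (nfst x) (npair m' u)) z
         end) (nsnd x) y
  | CMu f => eval A f (npair x y) 0 /\
             forall m, m < y -> exists v, eval A f (npair x m) v.+1
  end.

Fixpoint encode (c : code) : nat :=
  match c with
  | CZero => 0
  | CSucc => 1
  | CFst => 2
  | CSnd => 3
  | COracle => 4
  | CPair f g => 4 * npair (encode f) (encode g) + 5
  | CComp f g => 4 * npair (encode f) (encode g) + 6
  | CPrec f g => 4 * npair (encode f) (encode g) + 7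
  | CMu f => 4 * encode f + 8
  end.

Definition halts (A : set nat) (c : code) (x : nat) : Prop :=
  exists y, eval A c x y.

(* The oracle set0 is the constant function 0, so it adds no power. *)
Definition computable (f : nat -> nat) : Prop :=
  exists c, forall x, eval set0 c x (f x).

Definition computable2 (f : nat -> nat -> nat) : Prop :=
  computable (fun k => f (nfst k) (nsnd k)).

Definition ce (W : set nat) : Prop :=
  exists c, forall x, W x <-> halts set0 c x.

Definition jump (A : set nat) : set nat :=
  [set encode c | c in [set c | halts A c (encode c)]].

(* D_e : the finite set of positions of the ones in the binary expansion of e *)
Definition finite_set_of (e : nat) : set nat := [set i | odd (e %/ 2 ^ i)].

Definition ele (A B : set nat) : Prop :=
  exists Phi, ce Phi /\
    forall n, A n <-> exists e, Phi (npair n e) /\ finite_set_of e `<=` B.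

Definition eequiv (A B : set nat) : Prop := ele A B /\ ele B A.

Definition oplus (A B : set nat) : set nat :=
  [set n.*2 | n in A] `|` [set n.*2.+1 | n in B].

Definition total_set (A : set nat) : Prop := ele (~` A) A.

Definition semirecursive_set (A : set nat) : Prop :=
  exists s : nat -> nat -> bool, computable2 (fun n0 n1 => s n0 n1 : nat) /\
    forall n0 n1, A n0 \/ A n1 -> A (if s n0 n1 then n1 else n0).

(* An e-degree is an [eequiv]-class, i.e. a set of the form [edeg A]. *)
Definition edeg (A : set nat) : set (set nat) := [set B | eequiv A B].

Definition is_edegree (a : set (set nat)) : Prop := exists A, a = edeg A.

Definition edeg_le (a b : set (set nat)) : Prop :=
  exists A B, [/\ a A, b B & ele A B].

Definition edeg_join (a b : set (set nat)) : set (set nat) :=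
  [set C | exists A B, [/\ a A, b B & eequiv (oplus A B) C]].

Definition total_edegree (a : set (set nat)) : Prop :=
  is_edegree a /\ exists A, a A /\ total_set A.

Definition semirecursive_edegree (a : set (set nat)) : Prop :=
  is_edegree a /\ exists A, a A /\ semirecursive_set A.

(* The empty join is the least e-degree, that of set0. *)
Definition n_semirecursive_edegree (n : nat) (a : set (set nat)) : Prop :=
  exists s : 'I_n -> set (set nat),
    (forall i, semirecursive_edegree (s i)) /\
    a = \big[edeg_join/edeg set0]_(i < n) s i.

Definition zero_jump2 : set (set nat) :=
  let K2 := jump (jump set0) in edeg (oplus K2 (~` K2)).

(* A second-countable space is given by its enumerated subbasis, which
   generates the topology. *)
Record cbspace := CBSpace {
  point :> Type;
  subbase : nat -> set point
}.
Arguments subbase : clear implicits.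

Definition nbase (X : cbspace) (x : X) : set nat := [set e | subbase X e x].

Definition degree_spectrum (X : cbspace) : set (set (set nat)) :=
  [set edeg (nbase x) | x in [set: X]].

Definition point_space : cbspace := @CBSpace unit (fun=> set0).

Definition prod_space (X Y : cbspace) : cbspace :=
  @CBSpace (X * Y) (fun k =>
    if odd k then [set p | subbase Y k./2 p.2]
    else [set p | subbase X k./2 p.1]).

Fixpoint power_space (X : cbspace) (n : nat) : cbspace :=
  if n is m.+1 then prod_space X (power_space X m) else point_space.

Lemma nbase_prod (X Y : cbspace) (x : X) (y : Y) :
  @nbase (prod_space X Y) (x, y) = oplus (nbase x) (nbase y).
Proof.
apply/seteqP; split=> k; rewrite /nbase /oplus /=.
  by case: ifP => ok xk; [right|left]; exists k./2 => //=;
    rewrite -[RHS]odd_double_half ok.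
by case=> -[m mP <-] /=; rewrite odd_double /= ?doubleK ?uphalf_double.
Qed.

(* The code <<a,b>,c> names the rational (a - b) / (c + 1). *)
Definition rat_of_code (k : nat) : rat :=
  (((nfst (nfst k))%:Q - (nsnd (nfst k))%:Q) / (nsnd k).+1%:Q)%R.

Definition lower_reals (R : realType) : cbspace :=
  @CBSpace R (fun e => [set x : R | (ratr (rat_of_code e) < x)%R]).

Definition euclidean_reals (R : realType) : cbspace :=
  @CBSpace R (fun e => [set x : R |
    (ratr (rat_of_code (nfst e)) < x < ratr (rat_of_code (nsnd e)))%R]).

(* Main.v *)
(* Take open rational boxes of R^{n+1} as forcing conditions and let (x_0, ..., x_n) be
   generic for all sets {p | exists x, U(p,x) and not V(p,x)} with U, V c.e.; 0'' computes such a point. Let d be the degree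
   of the Euclidean real x_0 and c that of the left cuts of x_1, ..., x_n, and suppose that the
   join of c and d is that of semirecursive sets y_0, ..., y_n. Since d is total, the K-pair
   property of semirecursive sets gives a minimal I such that d is below the join of the y_i,
   i in I, and then the complement of each such y_i is below the join of the others. If I has at
   most one element, the left cut of x_0 is enumeration reducible to a co-c.e. set, against
   genericity. Otherwise two of the y_i are total modulo the join, and genericity puts every such
   set below d; so d together with n-1 semirecursive sets computes the n left cuts. A pigeonhole
   argument on n boxes, mimicking the proof that the n-cube has order dimension n, refutes this. *)
Require Import Defs.
From mathcomp Require Import all_boot all_order all_algebra.
From mathcomp Require Import all_classical all_reals.
From mathcomp Require Import zify.
From Stdlib Require Cantor.
Set Implicit Arguments.
Unset Strict Implicit.
Unset Printing Implicit Defensive.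
Import Order.TTheory GRing.Theory Num.Theory.
Local Open Scope classical_set_scope.

(** * Functions computable with an oracle *)

Arguments npair : simpl never.
Arguments nfst : simpl never.
Arguments nsnd : simpl never.

(** Genericity is applied to implications from [U] to [V] between c.e. relations on conditions: one
    that is true along the generic sequence is forced on all small boxes by some stage. As [V] is
    itself existential, the sets to be met are projections of differences of c.e. sets. Whether a
    box has an extension in [U] but not in [V] is a question c.e. in the first jump, whence the
    bound by the second. An enumeration operator reading a left cut sees only lower ends. Hence in
    coordinates 1 to n even disjoint boxes can be merged, by raising lower ends under a common older
    upper end. Coordinate 0 is read through both cuts and allows no such merging, so its side must
    be kept common to all boxes involved. A semirecursive set, in turn, behaves like a chain: of two
    bodies of positive information about it, one implies the other. So n-1 such sets single out at
    most n-1 of n boxes, and what the remaining box tells about them is already implied by the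
    others. *)

Lemma nfstK a b : nfst (npair a b) = a.
Proof. by rewrite /nfst /npair Cantor.cancel_of_to. Qed.

Lemma nsndK a b : nsnd (npair a b) = b.
Proof. by rewrite /nsnd /npair Cantor.cancel_of_to. Qed.

Lemma npairK k : npair (nfst k) (nsnd k) = k.
Proof. by rewrite /npair /nfst /nsnd -surjective_pairing Cantor.cancel_to_of. Qed.

Lemma npair_inj a b a' b' : npair a b = npair a' b' -> a = a' /\ b = b'.
Proof.
by move=> e; split; [rewrite -(nfstK a b) e nfstK|rewrite -(nsndK a b) e nsndK].
Qed.

Definition cfun (A : set nat) (f : nat -> nat) : Prop :=
  exists c, forall x, eval A c x (f x).

Fixpoint const_code (x : nat) : Defs.code :=
  if x is x'.+1 then CComp CSucc (const_code x') else CZero.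

Lemma eval_const_code A x y z : eval A (const_code x) y z <-> z = x.
Proof.
elim: x z => [|x IH] z //=; split=> [[u [/IH -> ->]]//|->].
by exists x; rewrite IH.
Qed.

Section Cfun.
Variable A : set nat.

Lemma cfun_ext f g : (forall x, f x = g x) -> cfun A f -> cfun A g.
Proof. by move=> fg [c cf]; exists c => x; rewrite -fg. Qed.

Lemma cfun_comp f g : cfun A f -> cfun A g -> cfun A (fun x => f (g x)).
Proof. by move=> [c cf] [d dg]; exists (CComp c d) => x /=; exists (g x). Qed.

Lemma cfun_const k : cfun A (fun _ => k).
Proof. by exists (const_code k) => x; apply/eval_const_code. Qed.

Lemma cfun_pair f g : cfun A f -> cfun A g -> cfun A (fun x => npair (f x) (g x)).
Proof.
by move=> [c cf] [d dg]; exists (CPair c d) => x /=; exists (f x), (g x).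
Qed.

Lemma cfun_id : cfun A (fun x => x).
Proof.
by exists (CPair CFst CSnd) => x /=; exists (nfst x), (nsnd x); rewrite npairK.
Qed.

Lemma cfun_fst f : cfun A f -> cfun A (fun x => nfst (f x)).
Proof. by move=> cf; apply: cfun_comp cf; exists CFst. Qed.

Lemma cfun_snd f : cfun A f -> cfun A (fun x => nsnd (f x)).
Proof. by move=> cf; apply: cfun_comp cf; exists CSnd. Qed.

Lemma cfun_succ f : cfun A f -> cfun A (fun x => (f x).+1).
Proof. by move=> cf; apply: cfun_comp cf; exists CSucc. Qed.

Lemma cfun_rec (h : nat -> nat -> nat) f g u v :
  cfun A f -> cfun A g -> (forall a, h a 0 = f a) ->
  (forall a m, h a m.+1 = g (npair a (npair m (h a m)))) ->
  cfun A u -> cfun A v -> cfun A (fun x => h (u x) (v x)).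
Proof.
move=> [c cf] [d dg] h0 hS cu cv.
suff ch : cfun A (fun k => h (nfst k) (nsnd k)).
  apply: cfun_ext (cfun_comp ch (cfun_pair cu cv)) => x.
  by rewrite nfstK nsndK.
exists (CPrec c d) => x /=; elim: (nsnd x) => [|m IH]; first by rewrite h0.
by exists (h (nfst x) m); split=> //; rewrite hS.
Qed.

End Cfun.

Create HintDb cfun discriminated.
#[export] Hint Constants Opaque : cfun.
#[export] Hint Resolve cfun_id cfun_const cfun_pair cfun_fst cfun_snd cfun_succ : cfun.
Ltac cf := solve [eauto 40 with cfun nocore].

Section Arith.
Variable A : set nat.

Lemma cfun_add f g : cfun A f -> cfun A g -> cfun A (fun x => f x + g x).
Proof.
apply: (@cfun_rec A addn id (fun k => (nsnd (nsnd k)).+1)); try cf.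
- exact: addn0.
- by move=> a m; rewrite !nsndK addnS.
Qed.

Lemma cfun_pred f : cfun A f -> cfun A (fun x => (f x).-1).
Proof.
move=> cf0; apply: (@cfun_rec A (fun _ m => m.-1) (fun=> 0) (fun k => nfst (nsnd k)) id);
  try cf; first by [].
by move=> a m; rewrite !(nsndK, nfstK).
Qed.

Lemma cfun_sub f g : cfun A f -> cfun A g -> cfun A (fun x => f x - g x).
Proof.
apply: (@cfun_rec A subn id (fun k => (nsnd (nsnd k)).-1)); first cf.
- by apply: cfun_pred; cf.
- exact: subn0.
- by move=> a m; rewrite !nsndK subnS.
Qed.

Lemma cfun_mul f g : cfun A f -> cfun A g -> cfun A (fun x => f x * g x).
Proof.
apply: (@cfun_rec A muln (fun=> 0) (fun k => nfst k + nsnd (nsnd k))); first cf.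
- by apply: cfun_add; cf.
- exact: muln0.
- by move=> a m; rewrite !nsndK nfstK mulnS.
Qed.

Lemma cfun_neg (P : nat -> bool) :
  cfun A (fun x => P x) -> cfun A (fun x => ~~ P x).
Proof.
by move=> cP; apply: cfun_ext (cfun_sub (cfun_const A 1) cP) => x; case: (P x).
Qed.

Lemma cfun_and (P Q : nat -> bool) :
  cfun A (fun x => P x) -> cfun A (fun x => Q x) -> cfun A (fun x => P x && Q x).
Proof.
by move=> cP cQ; apply: cfun_ext (cfun_mul cP cQ) => x; rewrite mulnb.
Qed.

Lemma cfun_or (P Q : nat -> bool) :
  cfun A (fun x => P x) -> cfun A (fun x => Q x) -> cfun A (fun x => P x || Q x).
Proof.
move=> cP cQ; apply: cfun_ext (cfun_neg (cfun_and (cfun_neg cP) (cfun_neg cQ))) => x.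
by rewrite negb_and !negbK.
Qed.

Lemma cfun_leq f g : cfun A f -> cfun A g -> cfun A (fun x => f x <= g x).
Proof.
move=> ca cb; apply: cfun_ext (cfun_sub (cfun_const A 1) (cfun_sub ca cb)) => x.
by rewrite -subn_eq0; case: (f x - g x) => // k; rewrite subSS sub0n.
Qed.

Lemma cfun_eq f g : cfun A f -> cfun A g -> cfun A (fun x => f x == g x).
Proof.
move=> ca cb; apply: cfun_ext (cfun_and (cfun_leq ca cb) (cfun_leq cb ca)) => x.
by rewrite eqn_leq.
Qed.

Lemma cfun_odd f : cfun A f -> cfun A (fun x => odd (f x)).
Proof.
move=> ca; apply: (@cfun_rec A (fun _ m => odd m) (fun=> 0)
  (fun k => 1 - nsnd (nsnd k)) id) => //; try cf.
- by apply: cfun_sub; cf.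
- by move=> a m; rewrite !nsndK /=; case: (odd m).
Qed.

Lemma cfun_half f : cfun A f -> cfun A (fun x => (f x)./2).
Proof.
move=> ca; apply: (@cfun_rec A (fun _ m => m./2) (fun=> 0)
  (fun k => odd (nfst (nsnd k)) + nsnd (nsnd k)) id) => //; try cf.
- by apply: cfun_add; [apply: cfun_odd|]; cf.
- by move=> a m; rewrite !(nsndK, nfstK) /= uphalf_half.
Qed.

Lemma cfun_iter (h : nat -> nat) f g :
  cfun A h -> cfun A f -> cfun A g -> cfun A (fun x => iter (f x) h (g x)).
Proof.
move=> ch ca cb; apply: (@cfun_rec A (fun a m => iter m h a) id
  (fun k => h (nsnd (nsnd k)))) => //; try cf.
- by apply: (cfun_comp ch); cf.
- by move=> a m; rewrite !nsndK.
Qed.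

Lemma cfun_all (P : nat -> nat -> bool) b :
  cfun A (fun k => P (nfst k) (nsnd k)) -> cfun A b ->
  cfun A (fun x => all (P x) (iota 0 (b x))).
Proof.
move=> cP cb; apply: (@cfun_rec A (fun a m => all (P a) (iota 0 m)) (fun=> 1)
  (fun k => nsnd (nsnd k) * P (nfst k) (nfst (nsnd k))) id) => //; try cf.
- apply: cfun_mul; first by cf.
  apply: (@cfun_ext A (fun k => P (nfst (npair (nfst k) (nfst (nsnd k))))
    (nsnd (npair (nfst k) (nfst (nsnd k)))))) => [k|]; first by rewrite nfstK nsndK.
  by apply: (cfun_comp cP); cf.
- by move=> a m; rewrite !(nfstK, nsndK) -addn1 iotaD all_cat /= andbT mulnb.
Qed.

Lemma cfun_oracle : cfun A (fun x => `[< A x >]).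
Proof.
exists COracle => x /=; case: (boolP `[< A x >]) => /asboolP h; first by left.
by right.
Qed.

End Arith.
#[export] Hint Resolve cfun_add cfun_sub cfun_pred cfun_mul cfun_neg cfun_and cfun_or
  cfun_leq cfun_eq cfun_odd cfun_half cfun_all : cfun.

(** * Sigma-1 classes *)

Lemma allnP (P : nat -> bool) b :
  reflect (forall i, i < b -> P i) (all P (iota 0 b)).
Proof.
apply: (iffP allP) => aP i; first by move=> ib; apply: aP; rewrite mem_iota.
by rewrite mem_iota => ib; apply: aP.
Qed.

(** Closure properties common to the sets c.e. in [A] and to the sets enumeration reducible to a
    fixed set, so that one argument by the shape of a formula serves both. Complements are absent,
    since an enumeration oracle is used only positively. *)
Class sigma_class (A : set nat) (C : set nat -> Prop) : Prop := {
  sc_dec : forall r : nat -> bool, cfun A (fun x => r x) -> C (fun x => r x);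
  sc_subst : forall P f, C P -> cfun A f -> C (fun x => P (f x));
  sc_and : forall P Q : set nat, C P -> C Q -> C (fun x => P x /\ Q x);
  sc_or : forall P Q : set nat, C P -> C Q -> C (fun x => P x \/ Q x);
  sc_ex : forall P : nat -> nat -> Prop,
    C (fun k => P (nfst k) (nsnd k)) -> C (fun x => exists y, P x y);
  sc_ball : forall (P : nat -> nat -> Prop) b,
    C (fun k => P (nfst k) (nsnd k)) -> cfun A b ->
    C (fun x => forall i, i < b x -> P x i)
}.

Lemma sc_ext (C : set nat -> Prop) (P Q : set nat) :
  (forall x, P x <-> Q x) -> C P -> C Q.
Proof. by move=> PQ; rewrite (_ : P = Q)//; apply/predeqP. Qed.

(** Every number is read as an infinite sequence through nested pairs, so no length is stored; only
    initial segments are ever prescribed. *)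
Definition seqnth (b i : nat) : nat := nfst (iter i nsnd b).

Arguments seqnth : simpl never.

Lemma seqnth_ex (z : nat -> nat) N : exists b, forall i, i < N -> seqnth b i = z i.
Proof.
elim: N z => [|N IH] z; first by exists 0.
have [b bP] := IH (fun i => z i.+1).
exists (npair (z 0) b) => -[_|i iN]; first by rewrite /seqnth /= nfstK.
by rewrite /seqnth iterSr nsndK -/(seqnth b i) bP.
Qed.

Lemma cfun_seqnth A f g : cfun A f -> cfun A g -> cfun A (fun x => seqnth (f x) (g x)).
Proof. by move=> cf0 cg; apply: cfun_fst; apply: cfun_iter => //; cf. Qed.
#[export] Hint Resolve cfun_seqnth : cfun.

(* The body matches the local recursion in [eval (CPrec f g)] so that the two are convertible. *)
Definition recrel (B : nat -> Prop) (St : nat -> nat -> nat -> Prop) :=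
  fix prec (m : nat) (z : nat) {struct m} : Prop :=
    match m with
    | 0 => B z
    | m'.+1 => exists u, prec m' u /\ St m' u z
    end.

(** The history of a recursion is finite. Coding it by one number turns the recursion into an
    existential quantifier followed by a bounded check. *)
Lemma recrelE B St m z : recrel B St m z <->
  exists b, [/\ B (seqnth b 0), seqnth b m = z &
    forall t, t < m -> St t (seqnth b t) (seqnth b t.+1)].
Proof.
elim: m z => [|m IH] z /=; split.
- move=> Bz; have [b bP] := seqnth_ex (fun=> z) 1.
  by exists b; rewrite bP.
- by case=> b [Bb <- _].
- case=> u [/IH [b [Bb <- bs]] St0].
  have [b' bP] := seqnth_ex (fun i => if i <= m then seqnth b i else z) m.+2.
  exists b'; rewrite !bP //= ltnn; split=> // t; rewrite ltnS => tm.
  rewrite !bP ?tm //; last by lia.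
  by case: ltngtP (tm) => // [tm' _|-> _ //]; apply: bs.
- case=> b [Bb <- bs]; exists (seqnth b m); split; last exact: bs.
  by apply/IH; exists b; split=> // t tm; apply: bs; lia.
Qed.

Ltac npair_simpl := rewrite ?(nfstK, nsndK).

Section SigmaClass.
Context A C {sc : sigma_class A C}.

Lemma sc_and3 (P Q R : set nat) : C P -> C Q -> C R -> C (fun x => [/\ P x, Q x & R x]).
Proof.
move=> cP cQ cR; apply: sc_ext (sc_and cP (sc_and cQ cR)) => x.
by split=> [[? []]|[]].
Qed.

Lemma sc_subst2 (P : nat -> nat -> Prop) f g :
  C (fun k => P (nfst k) (nsnd k)) -> cfun A f -> cfun A g ->
  C (fun x => P (f x) (g x)).
Proof.
move=> cP cf0 cg; apply: sc_ext (sc_subst cP (cfun_pair cf0 cg)) => x.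
by npair_simpl.
Qed.

Lemma sc_subst3 (P : nat -> nat -> nat -> Prop) f g h :
  C (fun k => P (nfst k) (nfst (nsnd k)) (nsnd (nsnd k))) ->
  cfun A f -> cfun A g -> cfun A h -> C (fun x => P (f x) (g x) (h x)).
Proof.
move=> cP cf0 cg ch.
apply: sc_ext (sc_subst cP (cfun_pair cf0 (cfun_pair cg ch))) => x.
by npair_simpl.
Qed.

Lemma sc_recrel (B : nat -> nat -> Prop) (St : nat -> nat -> nat -> nat -> Prop) f g :
  C (fun k => B (nfst k) (nsnd k)) ->
  C (fun k => St (nfst k) (nfst (nsnd k)) (nfst (nsnd (nsnd k))) (nsnd (nsnd (nsnd k)))) ->
  cfun A f -> cfun A g -> C (fun x => recrel (B x) (St x) (f x) (g x)).
Proof.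
move=> cB cSt cf0 cg.
apply: (@sc_ext C (fun x => exists b, [/\ B x (seqnth b 0), seqnth b (f x) == g x &
    forall t, t < f x -> St x t (seqnth b t) (seqnth b t.+1)])) => [x|].
  by rewrite recrelE; split=> -[b [h1 h2 h3]]; exists b; split=> //; apply/eqP.
have cfk : cfun A (fun k => f (nfst k)) by apply: cfun_comp cf0 _; cf.
have cgk : cfun A (fun k => g (nfst k)) by apply: cfun_comp cg _; cf.
apply: sc_ex; apply: sc_and3.
- by apply: (@sc_subst2 B (fun k => nfst k)) => //; cf.
- by apply: sc_dec; cf.
- apply: (@sc_ball A C _ (fun k t => St (nfst k) t (seqnth (nsnd k) t)
    (seqnth (nsnd k) t.+1))) => //.
  pose F k := npair (nfst (nfst k)) (npair (nsnd k)
    (npair (seqnth (nsnd (nfst k)) (nsnd k)) (seqnth (nsnd (nfst k)) (nsnd k).+1))).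
  have cF : cfun A F by rewrite /F; cf.
  by apply: sc_ext (sc_subst cSt cF) => k; rewrite /F; npair_simpl.
Qed.

End SigmaClass.

Lemma collect (P : nat -> nat -> Prop) b : (forall i, i < b -> exists w, P i w) ->
  exists N, forall i, i < b -> exists2 w, w < N & P i w.
Proof.
elim: b => [|b IH] aP; first by exists 0.
have [|N NP] := IH; first by move=> i ib; apply: aP; lia.
have [w Pw] := aP b (ltnSn b).
exists (N + w).+1 => i; rewrite ltnS leq_eqVlt => /orP[/eqP ->|ib].
  by exists w => //; lia.
by have [v vN Pv] := NP i ib; exists v => //; lia.
Qed.

Definition sigma1 (A P : set nat) : Prop :=
  exists2 r : nat -> bool, cfun A (fun x => r x) & forall x, P x <-> exists w, r (npair x w).

Lemma cfun_appb A (r : nat -> bool) f :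
  cfun A (fun x => r x) -> cfun A f -> cfun A (fun x => r (f x)).
Proof. exact: cfun_comp. Qed.

#[export] Instance sigma1_sigma A : sigma_class A (sigma1 A).
Proof.
split.
- move=> r cr; exists (fun k => r (nfst k)) => [|x]; first by apply: cfun_appb; cf.
  by split=> [rx|[w]]; [exists 0|]; npair_simpl.
- move=> P f [r cr rP] cf0; exists (fun k => r (npair (f (nfst k)) (nsnd k))).
    apply: cfun_appb => //; apply: cfun_pair; last by cf.
    by apply: cfun_comp cf0 _; cf.
  by move=> x; rewrite rP; split=> -[w rw]; exists w; move: rw; npair_simpl.
- move=> P Q [r cr rP] [r' cr' rP'].
  exists (fun k => r (npair (nfst k) (nfst (nsnd k))) && r' (npair (nfst k) (nsnd (nsnd k)))).
    by apply: cfun_and; apply: cfun_appb => //; cf.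
  move=> x; rewrite rP rP'; split=> [[[w rw] [w' rw']]|[w]].
    by exists (npair w w'); npair_simpl; rewrite rw.
  by npair_simpl => /andP[? ?]; split; [exists (nfst w)|exists (nsnd w)].
- move=> P Q [r cr rP] [r' cr' rP'].
  exists (fun k => r k || r' k); first by apply: cfun_or.
  move=> x; rewrite rP rP'; split=> [[[w rw]|[w rw]]|[w /orP[rw|rw]]].
  + by exists w; rewrite rw.
  + by exists w; rewrite rw orbT.
  + by left; exists w.
  + by right; exists w.
- move=> P [r cr rP].
  exists (fun k => r (npair (npair (nfst k) (nfst (nsnd k))) (nsnd (nsnd k)))).
    by apply: cfun_appb => //; cf.
  move=> x; split=> [[y]|[w]].
    have := rP (npair x y); npair_simpl => -> [w rw].
    by exists (npair y w); npair_simpl.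
  npair_simpl => rw; exists (nfst w); have := rP (npair x (nfst w)); npair_simpl => ->.
  by exists (nsnd w).
- move=> P b [r cr rP] cb.
  exists (fun k => all (fun i => ~~ all (fun w => ~~ r (npair (npair (nfst k) i) w))
    (iota 0 (nsnd k))) (iota 0 (b (nfst k)))).
    have cbk : cfun A (fun k => b (nfst k)) by apply: cfun_comp cb _; cf.
    apply: cfun_all => //; apply: cfun_neg.
    apply: (@cfun_all A (fun k w => ~~ r (npair (npair (nfst (nfst k)) (nsnd k)) w))).
      by apply: cfun_neg; apply: cfun_appb => //; cf.
    by cf.
  have rP' x i : P x i <-> exists w, r (npair (npair x i) w).
    by rewrite -rP; npair_simpl.
  move=> x; split=> [|[N]].
    move=> aP; have [|N NP] := @collect (fun i w => r (npair (npair x i) w)) (b x).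
      by move=> i ib; apply/rP'/aP.
    exists N; npair_simpl; apply/allnP => i ib; apply/negP => /allnP h.
    by have [w wN rw] := NP i ib; have := h w wN; rewrite rw.
  npair_simpl => /allnP h i ib; have /negP := h i ib; apply: contra_notP => nP.
  by apply/allnP => w wN; apply/negP => rw; apply: nP; apply/rP'; exists w.
Qed.

(** Induction on [c] gives a separate decidable matrix for each program; uniformity in the program
    enters only later, through [smn] and the jump. *)
Lemma eval_sigma1 A c : sigma1 A (fun k => eval A c (nfst k) (nsnd k)).
Proof.
elim: c => [||||| f IHf g IHg| f IHf g IHg| f IHf g IHg| f IHf] /=.
- by apply: (@sc_ext _ (fun k => nsnd k == 0)) => [x|]; [split=> /eqP|apply: sc_dec; cf].
- by apply: (@sc_ext _ (fun k => nsnd k == (nfst k).+1)) => [x|];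
    [split=> /eqP|apply: sc_dec; cf].
- by apply: (@sc_ext _ (fun k => nsnd k == nfst (nfst k))) => [x|];
    [split=> /eqP|apply: sc_dec; cf].
- by apply: (@sc_ext _ (fun k => nsnd k == nsnd (nfst k))) => [x|];
    [split=> /eqP|apply: sc_dec; cf].
- apply: (@sc_ext _ (fun k => nsnd k == `[< A (nfst k) >])) => [x|].
    case: (boolP `[< A (nfst x) >]) => /asboolP h /=.
      by split=> [/eqP ->|[[]|[]]//]; [left|move=> _ ->].
    by split=> [/eqP ->|[[]|[]]//]; [right|move=> _ ->].
  apply: sc_dec; apply: cfun_eq; first by cf.
  by apply: cfun_comp (cfun_oracle A) _; cf.
- apply: sc_ex; apply: sc_ex.
  apply: (@sc_ext _ (fun k => [/\ eval A f (nfst (nfst (nfst k))) (nsnd (nfst k)),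
    eval A g (nfst (nfst (nfst k))) (nsnd k)
    & nsnd (nfst (nfst k)) == npair (nsnd (nfst k)) (nsnd k)])).
    by move=> k; split=> -[? ? /eqP ?].
  apply: sc_and3.
  + by apply: (sc_subst2 IHf); cf.
  + by apply: (sc_subst2 IHg); cf.
  + by apply: sc_dec; cf.
- apply: sc_ex; apply: sc_and.
  + by apply: (sc_subst2 IHg); cf.
  + by apply: (sc_subst2 IHf); cf.
- apply: (@sc_recrel _ _ _ (fun k z => eval A f (nfst (nfst k)) z)
    (fun k m u z => eval A g (npair (nfst (nfst k)) (npair m u)) z)
    (fun k => nsnd (nfst k)) (fun k => nsnd k)); try cf.
  + by apply: (sc_subst2 IHf); cf.
  + by apply: (sc_subst2 IHg); cf.
- apply: sc_and.
  + by apply: (sc_subst2 IHf); cf.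
  + apply: sc_ball; last by cf.
    by apply: sc_ex; apply: (sc_subst2 IHf); cf.
Qed.

Lemma eval_fun A c x y z : eval A c x y -> eval A c x z -> y = z.
Proof.
elim: c x y z => [||||| f IHf g IHg| f IHf g IHg| f IHf g IHg| f IHf] x y z //=;
  try by move=> -> ->.
- by case=> -[Ax ->]; case=> -[Ax' ->].
- by move=> [u [v [fu gv ->]]] [u' [v' [fu' gv' ->]]]; rewrite (IHf _ _ _ fu fu') (IHg _ _ _ gv gv').
- by move=> [u [gu fu]] [v [gv fv]]; move: fv; rewrite -(IHg _ _ _ gu gv) => /(IHf _ _ _ fu).
- elim: (nsnd x) y z => [|m IH] y z; first exact: IHf.
  move=> [u [pu gu]] [v [pv gv]]; move: gv; rewrite -(IH _ _ pu pv); exact: IHg.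
- move=> [fy ly] [fz lz]; case: (ltngtP y z) => // yz.
    by have [v fv] := lz _ yz; have := IHf _ _ _ fy fv.
  by have [v fv] := ly _ yz; have := IHf _ _ _ fz fv.
Qed.

Definition ce_in (A W : set nat) : Prop :=
  exists c, forall x, W x <-> halts A c x.

Lemma ce_inE A W : ce_in A W <-> sigma1 A W.
Proof.
split=> [[c cP]|[r [c cr] rP]].
  by apply: (@sc_ext _ (fun x => exists y, eval A c x y)) => [x|]; [rewrite cP|apply/sc_ex/eval_sigma1].
(* [CMu] searches for a zero, so the matrix is negated: the value 0 means that [r] holds. *)
have [d dP] : cfun A (fun x => ~~ r x) by apply: cfun_neg; exists c.
exists (CMu d) => x; rewrite rP; split=> [[w rw]|[w [dw _]]].
  have [m rm mmin] := ex_minnP (ex_intro (fun w => r (npair x w)) w rw).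
  exists m; split=> [|i im]; first by have := dP (npair x m); rewrite rm.
  have := dP (npair x i); case: (boolP (r _)) => [/mmin|_ /=]; first by lia.
  by exists 0.
exists w; have := eval_fun dw (dP (npair x w)).
by case: (r _).
Qed.

(** * Enumeration reducibility *)

#[export] Instance ce_in_sigma A : sigma_class A (ce_in A).
Proof.
by rewrite (_ : ce_in A = sigma1 A); [exact: sigma1_sigma|apply/predeqP => W; exact: ce_inE].
Qed.

#[export] Instance ce_sigma : sigma_class set0 ce := ce_in_sigma set0.

Definition fin_mem (e i : nat) : bool := odd (e %/ 2 ^ i).

Lemma fin_mem0 i : fin_mem 0 i = false.
Proof. by rewrite /fin_mem div0n. Qed.

Lemma fin_mem_lt e i : fin_mem e i -> i < e.
Proof.
move=> h; apply: (leq_trans (ltn_expl i (ltnSn 1))).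
by rewrite leqNgt; apply: contraTN h => lt; rewrite /fin_mem divn_small.
Qed.

Lemma fin_mem_ex (P : nat -> Prop) N :
  exists e, forall i, fin_mem e i <-> i < N /\ P i.
Proof.
elim: N P => [|N IH] P.
  by exists 0 => i; rewrite fin_mem0; split=> // -[].
have [e eP] := IH (fun i => P i.+1).
exists (`[< P 0 >] + e.*2) => -[|i].
  rewrite /fin_mem expn0 divn1 oddD odd_double addbF oddb.
  by split=> [/asboolP|[_ ?]] //; apply/asboolP.
have -> : fin_mem (`[< P 0 >] + e.*2) i.+1 = fin_mem e i.
  by rewrite /fin_mem expnS divnMA divn2 half_bit_double.
by rewrite eP ltnS.
Qed.

Lemma cfun_fin_mem A f g :
  cfun A f -> cfun A g -> cfun A (fun x => fin_mem (f x) (g x)).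
Proof.
move=> cf0 cg.
apply: (@cfun_ext A (fun x => odd (iter (g x) half (f x)))) => [x|].
  rewrite /fin_mem; congr (nat_of_bool (odd _)).
  elim: (g x) (f x) => [|i IH] e; first by rewrite divn1.
  by rewrite iterSr IH expnS divnMA divn2.
by apply: cfun_odd; apply: cfun_iter => //; cf.
Qed.
#[export] Hint Resolve cfun_fin_mem : cfun.

(** Members of a coded finite set are smaller than its code, so the quantifier over them is
    bounded. *)
Lemma sc_fin_sub A C {sc : sigma_class A C} (P : nat -> nat -> Prop) f :
  C (fun k => P (nfst k) (nsnd k)) -> cfun A f ->
  C (fun x => forall i, fin_mem (f x) i -> P x i).
Proof.
move=> cP cf0.
apply: (@sc_ext _ (fun x => forall i, i < f x -> ~~ fin_mem (f x) i \/ P x i)) => [x|].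
  split=> h i; last by case: (boolP (fin_mem _ _)) => [/h|_ _]; [right|left].
  by move=> fi; case: (h i (fin_mem_lt fi)) => //; rewrite fi.
apply: (@sc_ball A C _ (fun x i => ~~ fin_mem (f x) i \/ P x i)) => //.
apply: sc_or => //; apply: sc_dec; apply: cfun_neg; apply: cfun_fin_mem; last by cf.
by apply: cfun_comp cf0 _; cf.
Qed.

(* [ele] with its arguments swapped, so that [E X] is a class of sets. *)
Definition E (X S : set nat) : Prop := ele S X.

Definition fin_sub (e e' : nat) : bool :=
  all (fun i => ~~ fin_mem e i || fin_mem e' i) (iota 0 e).

Lemma fin_subP e e' : fin_sub e e' <-> forall i, fin_mem e i -> fin_mem e' i.
Proof.
split=> [/allnP h i ei|h]; first by have := h i (fin_mem_lt ei); rewrite ei.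
by apply/allnP => i _; case: (boolP (fin_mem e i)) => // /h.
Qed.

Lemma cfun_fin_sub A f g :
  cfun A f -> cfun A g -> cfun A (fun x => fin_sub (f x) (g x)).
Proof.
move=> cf0 cg; apply: (@cfun_all A (fun x i => ~~ fin_mem (f x) i || fin_mem (g x) i)) => //.
have ? : cfun A (fun k => f (nfst k)) by apply: cfun_comp cf0 _; cf.
have ? : cfun A (fun k => g (nfst k)) by apply: cfun_comp cg _; cf.
by cf.
Qed.
#[export] Hint Resolve cfun_fin_sub : cfun.

(** For conjunction and bounded quantification the new operator accepts every finite set that
    includes the required ones, so one sufficiently long initial piece of [X] serves them all. *)
#[export] Instance E_sigma X : sigma_class set0 (E X).
Proof.
split.
- move=> r cr; exists (fun k => r (nfst k)); split.
    by apply: sc_dec; apply: cfun_appb => //; cf.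
  move=> x; split=> [rx|[e]]; npair_simpl; last by case.
  by exists 0; npair_simpl; split=> // i; rewrite /finite_set_of /= div0n.
- move=> P f [Phi [cPhi PhiP]] cf0.
  exists (fun k => Phi (npair (f (nfst k)) (nsnd k))); split.
    apply: sc_subst => //; apply: cfun_pair; last by cf.
    by apply: cfun_comp cf0 _; cf.
  by move=> x; rewrite PhiP; split=> -[e h]; exists e; move: h; npair_simpl.
- move=> P Q [Phi [cPhi PhiP]] [Psi [cPsi PsiP]].
  exists (fun k => exists e e', [/\ Phi (npair (nfst k) e), Psi (npair (nfst k) e') &
    fin_sub e (nsnd k) && fin_sub e' (nsnd k)]); split.
    apply: sc_ex; apply: sc_ex; apply: sc_and3.
    + by apply: sc_subst => //; cf.
    + by apply: sc_subst => //; cf.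
    + by apply: sc_dec; cf.
  move=> x; rewrite PhiP PsiP; split=> [[[e [h1 h2]] [e' [h1' h2']]]|[e [[d [d']]]]].
    have [b bP] := fin_mem_ex X (e + e').
    exists b; npair_simpl; split; last by move=> i /bP[].
    exists e, e'; split=> //; apply/andP; split; apply/fin_subP => i ei; apply/bP.
      by have := fin_mem_lt ei; split; [lia|apply: h2].
    by have := fin_mem_lt ei; split; [lia|apply: h2'].
  npair_simpl => -[h1 h2 /andP[/fin_subP s1 /fin_subP s2]] eX.
  by split; [exists d|exists d']; split=> // i ? ; apply: eX; [apply: s1|apply: s2].
- move=> P Q [Phi [cPhi PhiP]] [Psi [cPsi PsiP]].
  exists (fun k => Phi k \/ Psi k); split; first exact: sc_or.
  move=> x; rewrite PhiP PsiP; split=> [[[e [h1 h2]]|[e [h1 h2]]]|[e [[h1|h1] h2]]].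
  + by exists e; split=> //; left.
  + by exists e; split=> //; right.
  + by left; exists e.
  + by right; exists e.
- move=> P [Phi [cPhi PhiP]].
  exists (fun k => exists y, Phi (npair (npair (nfst k) y) (nsnd k))); split.
    by apply: sc_ex; apply: sc_subst => //; cf.
  move=> x; split=> [[y]|[e [[y]]]].
    have := PhiP (npair x y); npair_simpl => -> [e [h1 h2]].
    by exists e; split=> //; exists y; npair_simpl.
  npair_simpl => h1 h2; exists y; have := PhiP (npair x y); npair_simpl => ->.
  by exists e.
- move=> P b [Phi [cPhi PhiP]] cb.
  have PhiP' x i : P x i <-> exists e, Phi (npair (npair x i) e) /\ finite_set_of e `<=` X.
    by rewrite -PhiP; npair_simpl.
  exists (fun k => forall i, i < b (nfst k) -> exists e,
    Phi (npair (npair (nfst k) i) e) /\ fin_sub e (nsnd k)); split.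
    apply: sc_ball; last by apply: cfun_comp cb _; cf.
    apply: sc_ex; apply: sc_and; first by apply: sc_subst => //; cf.
    by apply: sc_dec; cf.
  move=> x; split=> [aP|[e []]].
    have [|N NP] := @collect (fun i e => Phi (npair (npair x i) e) /\ finite_set_of e `<=` X) (b x).
      by move=> i /aP /PhiP'.
    have [d dP] := fin_mem_ex X N.
    exists d; npair_simpl; split; last by move=> i /dP[].
    move=> i /NP[e eN [h1 h2]]; exists e; split=> //; apply/fin_subP => j ej.
    by apply/dP; have := fin_mem_lt ej; split; [lia|apply: h2].
  npair_simpl => h eX i /h [d [h1 /fin_subP h2]]; apply/PhiP'; exists d; split=> // j dj.
  by apply: eX; apply: h2.
Qed.

Lemma E_ce X W : ce W -> E X W.
Proof.
move=> cW; exists (fun k => W (nfst k)); split; first by apply: sc_subst => //; cf.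
move=> x; split=> [Wx|[e]]; npair_simpl; last by case.
by exists 0; npair_simpl; split=> // i; rewrite /finite_set_of /= div0n.
Qed.

Lemma E_refl X : E X X.
Proof.
exists (fun k => fin_mem (nsnd k) (nfst k)); split; first by apply: sc_dec; cf.
move=> x; split=> [Xx|[e]]; npair_simpl; last by case=> h; apply.
have [e eP] := fin_mem_ex (fun i => i = x) x.+1.
by exists e; npair_simpl; split; [apply/eP|move=> i /eP[_ ->]].
Qed.

(** The operator defines [Z] positively over [Y], and [E X] is closed under such definitions once it
    contains [Y]. *)
Lemma E_trans X Y Z : E X Y -> E Y Z -> E X Z.
Proof.
move=> XY [Phi [cPhi PhiP]].
apply: (@sc_ext _ (fun x => exists e, Phi (npair x e) /\ forall i, fin_mem e i -> Y i)).
  by move=> x; rewrite PhiP.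
apply: sc_ex; apply: sc_and; first by apply: sc_subst; [exact: E_ce|cf].
apply: (@sc_fin_sub _ _ _ (fun _ i => Y i)); last by cf.
by apply: sc_subst => //; cf.
Qed.

Lemma E_set0 X : E X set0.
Proof. by apply: (@sc_ext _ (fun=> false)) => //; apply: sc_dec; cf. Qed.

Lemma E_set0_ce W : E set0 W -> ce W.
Proof.
case=> Phi [cPhi PhiP].
apply: (@sc_ext _ (fun x => exists e, Phi (npair x e) /\ forall i, fin_mem e i -> false)).
  by move=> x; rewrite PhiP; split=> -[e [h1 h2]]; exists e; split=> // i /h2.
apply: sc_ex; apply: sc_and; first by apply: sc_subst => //; cf.
apply: (@sc_fin_sub _ _ _ (fun _ i => false)); last by cf.
by apply: sc_dec; cf.
Qed.

Lemma oplusE A B x : oplus A B x <-> if odd x then B x./2 else A x./2.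
Proof.
split=> [[[m Am <-]|[m Bm <-]]|]; rewrite /= ?odd_double /= ?doubleK ?uphalf_double //.
by case: ifP => ox h; [right|left]; exists x./2 => //;
  rewrite -[RHS]odd_double_half ox.
Qed.

Lemma E_oplus X A B : E X (oplus A B) <-> E X A /\ E X B.
Proof.
split=> [h|[hA hB]].
  split.
    apply: (@sc_ext _ (fun x => oplus A B (x + x))) => [x|].
      by rewrite addnn oplusE odd_double doubleK.
    by apply: sc_subst => //; cf.
  apply: (@sc_ext _ (fun x => oplus A B (x + x).+1)) => [x|].
    by rewrite addnn oplusE /= odd_double /= uphalf_double.
  by apply: sc_subst => //; cf.
apply: (@sc_ext _ (fun x => (odd x /\ B x./2) \/ (~~ odd x /\ A x./2))) => [x|].
  by rewrite oplusE; case: (odd x); split; [case=> -[]|left|case=> -[]|right].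
apply: sc_or; apply: sc_and; try (by apply: sc_subst => //; cf); by apply: sc_dec; cf.
Qed.

Lemma E_oplusl A B : E (oplus A B) A.
Proof. by have /E_oplus[] := E_refl (oplus A B). Qed.

Lemma E_oplusr A B : E (oplus A B) B.
Proof. by have /E_oplus[] := E_refl (oplus A B). Qed.

(** Tags are the indices themselves rather than positions in [ks], so dropping an index leaves the
    other parts unchanged. *)
Definition ojoin (ks : seq nat) (y : nat -> set nat) : set nat :=
  fun a => nfst a \in ks /\ y (nfst a) (nsnd a).

Lemma cfun_mem A f (s : seq nat) : cfun A f -> cfun A (fun x => f x \in s).
Proof.
move=> cf0; elim: s => [|a s IH]; first exact: cfun_const.
by apply: (@cfun_ext A (fun x => (f x == a) || (f x \in s))) => [x|]; [rewrite inE|cf].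
Qed.
#[export] Hint Resolve cfun_mem : cfun.

(** The sets [P k] may lie in the class for unrelated reasons; as the list is finite, a disjunction
    over it combines them. *)
Lemma sc_tags A C {sc : sigma_class A C} (ks : seq nat) (P : nat -> nat -> Prop) f :
  (forall k, k \in ks -> C (P k)) -> cfun A f ->
  C (fun x => f x \in ks /\ P (f x) x).
Proof.
move=> cP cf0; elim: ks cP => [|k ks IH] cP.
  apply: (@sc_ext _ (fun=> false)) => [x|]; first by split=> // -[].
  by apply: sc_dec; cf.
apply: (@sc_ext _ (fun x => (f x == k /\ P k x) \/ (f x \in ks /\ P (f x) x))) => [x|].
  rewrite inE; split=> [[[/eqP -> h]|[h1 h2]]|[/orP[/eqP e|h1] h2]].
  - by rewrite eqxx.
  - by rewrite h1 orbT.
  - by left; rewrite -e eqxx.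
  - by right.
apply: sc_or; last by apply: IH => k' kk; apply: cP; rewrite inE kk orbT.
by apply: sc_and; [apply: sc_dec; cf|apply: cP; rewrite inE eqxx].
Qed.

Lemma E_ojoin X ks y : E X (ojoin ks y) <-> forall k, k \in ks -> E X (y k).
Proof.
split=> [h k kks|h].
  apply: (@sc_ext _ (fun u => ojoin ks y (npair k u))) => [u|].
    by rewrite /ojoin; npair_simpl; rewrite kks; split=> [[]|].
  by apply: sc_subst => //; cf.
apply: (@sc_tags _ _ _ ks (fun k a => y k (nsnd a))) => [k kks|]; last by cf.
by apply: sc_subst; [exact: h|cf].
Qed.

(** * Semirecursive sets and jumps *)

(* If [u] is in [y] then [{v | s u v}] is contained in [y], and otherwise it contains [y];
   a [u] outside [y] for which it yields no contradiction recovers [T] without [y]. *)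
Lemma semirec_total y z T : semirecursive_set y ->
  E (oplus z y) T -> E (oplus z y) (~` T) ->
  (E z T /\ E z (~` T)) \/ E z (~` y).
Proof.
move=> [s [cs sP]] [Phi [cPhi PhiP]] [Psi [cPsi PsiP]].
pose down u x := (odd x /\ s u x./2) \/ (~~ odd x /\ z x./2).
pose val (F : set nat) u k := exists e, F (npair k e) /\ forall x, fin_mem e x -> down u x.
have cval F f g : ce F -> cfun set0 f -> cfun set0 g -> E z (fun x => val F (f x) (g x)).
  move=> cF cf0 cg; apply: sc_subst2 => //; apply: sc_ex; apply: sc_and.
    by apply: sc_subst; [exact: E_ce|cf].
  apply: (@sc_fin_sub _ _ _ (fun x i => down (nfst (nfst x)) i)); last by cf.
  apply: sc_or; apply: sc_and; try (by apply: sc_dec; cf).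
    apply: (@sc_subst2 _ _ _ (fun u v => s u v)); try cf.
    exact: sc_dec.
  by apply: sc_subst; [exact: E_refl|cf].
have sy u v : y u -> s u v -> y v.
  by move=> yu suv; have := sP u v (or_introl yu); rewrite suv.
have nsy u v : ~ y u -> y v -> s u v.
  by move=> nyu yv; have := sP u v (or_intror yv); case: (s u v).
have inT F u k : y u -> val F u k -> exists e, F (npair k e) /\ finite_set_of e `<=` oplus z y.
  move=> yu [e [h1 h2]]; exists e; split=> // i /h2 di; apply/oplusE.
  by case: di => -[]; case: (odd i) => // _ => /sy; apply.
have Tin F u k : ~ y u ->
    (exists e, F (npair k e) /\ finite_set_of e `<=` oplus z y) -> val F u k.
  move=> nyu [e [h1 h2]]; exists e; split=> // i /h2 /oplusE.
  by case: ifP => oi h; [left; split; [|exact: nsy h]|right; rewrite oi].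
have VE : E z (fun u => exists k, val Phi u k /\ val Psi u k).
  by apply: sc_ex; apply: sc_and; apply: cval => //; cf.
have [[u [nyu nV]]|h] := pselect (exists u, ~ y u /\ ~ exists k, val Phi u k /\ val Psi u k).
  left; split.
    apply: (@sc_ext _ (fun k => val Phi u k)) => [k|]; last by apply: cval => //; cf.
    split=> [vk|/PhiP/(Tin _ u _ nyu)]; last exact.
    apply: contrapT => /PsiP/(Tin _ u _ nyu) nTk; apply: nV.
    by exists k.
  apply: (@sc_ext _ (fun k => val Psi u k)) => [k|]; last by apply: cval => //; cf.
  split=> [vk Tk|/PsiP/(Tin _ u _ nyu)]; last exact.
  apply: nV; exists k; split=> //.
  by apply: Tin => //; apply/PhiP.
right; apply: sc_ext VE => u; split=> [[k [v1 v2]] yu|nyu].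
  by have /PsiP := inT _ _ _ yu v2; apply; apply/PhiP/(inT _ _ _ yu v1).
by apply: contrapT => nV; apply: h; exists u.
Qed.

(** An index violating the last clause excludes the second alternative of [semirec_total], so the
    first one allows it to be dropped. The list shrinks until every remaining index satisfies the
    clause. *)
Lemma min_support T ks y : (forall k, k \in ks -> semirecursive_set (y k)) ->
  E (ojoin ks y) T -> E (ojoin ks y) (~` T) ->
  exists ks', [/\ {subset ks' <= ks}, E (ojoin ks' y) T &
    forall i, i \in ks' -> E (ojoin [seq k <- ks' | k != i] y) (~` y i)].
Proof.
elim: {ks}(size ks).+1 {-2}ks (ltnSn (size ks)) => // N IH ks; rewrite ltnS => sks ssr kT knT.
have [h|] := pselect (forall i, i \in ks -> E (ojoin [seq k <- ks | k != i] y) (~` y i)).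
  by exists ks; split.
move/existsNP => [i /not_implyP[iks ni]].
set z := ojoin _ y in ni.
have zks : E (oplus z (y i)) (ojoin ks y).
  apply/E_ojoin => k kks; have [->|ki] := eqVneq k i; first exact: E_oplusr.
  apply: (E_trans (E_oplusl _ _)).
  by have /E_ojoin := E_refl z; apply; rewrite mem_filter ki.
have [[zT znT]|//] := semirec_total (ssr i iks) (E_trans zks kT) (E_trans zks knT).
have sz : size [seq k <- ks | k != i] < N.
  rewrite size_filter (leq_trans _ sks) // -(count_predC (fun k => k != i) ks).
  rewrite -[ltnLHS]addn0 ltn_add2l -has_count; apply/hasP; exists i => //=.
  by rewrite negbK.
have [|ks' [s1 s2 s3]] := IH _ sz _ zT znT.
  by move=> k; rewrite mem_filter => /andP[_]; apply: ssr.
exists ks'; split=> // k /s1; by rewrite mem_filter => /andP[].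
Qed.

(** * Program codes, hard-wired inputs and the jump *)

Lemma encode_inj : injective encode.
Proof.
(* The offsets 5 to 8 differ modulo 4 and exceed the atomic codes 0 to 4, so codes of different
   constructors never coincide. *)
have npE a b a' b' k k' : 4 * npair a b + k = 4 * npair a' b' + k' -> k = k' -> a = a' /\ b = b'.
  by move=> h kk; apply: npair_inj; lia.
elim=> [||||| f IHf g IHg| f IHf g IHg| f IHf g IHg| f IHf] [||||| f' g'| f' g'| f' g'| f'] //=;
  try lia.
- by move=> /npE /(_ erefl) [/IHf -> /IHg ->].
- by move=> /npE /(_ erefl) [/IHf -> /IHg ->].
- by move=> /npE /(_ erefl) [/IHf -> /IHg ->].
- by move=> h; rewrite (IHf f') //; lia.
Qed.

Lemma jumpE A c : jump A (encode c) <-> halts A c (encode c).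
Proof. by split=> [[c' h /encode_inj <-]|h] //; exists c. Qed.

(** This is the [CComp] clause of [encode]: the program [e] run after the constant [x]. It ignores
    its own input, so the diagonal question asked by [jump] becomes the question whether [e] halts
    on [x]. *)
Definition smn (e x : nat) : nat := 4 * npair e (encode (const_code x)) + 6.

Lemma jump_smn A c x : jump A (smn (encode c) x) <-> halts A c x.
Proof.
rewrite -[smn _ _]/(encode (CComp c (const_code x))) jumpE.
split=> [[y /= [u [/eval_const_code -> h]]]|[y h]]; first by exists y.
by exists y, x; split=> //; apply/eval_const_code.
Qed.

Lemma cfun_smn A f g : cfun A f -> cfun A g -> cfun A (fun x => smn (f x) (g x)).
Proof.
move=> cf0 cg.
have ? : cfun A (fun x => encode (const_code (g x))).
  apply: (@cfun_rec A (fun _ m => encode (const_code m)) (fun=> 0)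
    (fun k => 4 * npair 1 (nsnd (nsnd k)) + 6) id) => //; try cf.
  by move=> a m; npair_simpl.
by rewrite /smn; cf.
Qed.
#[export] Hint Resolve cfun_smn : cfun.

Lemma ce_in_jump A W : ce_in A W -> exists e, forall x, W x <-> jump A (smn e x).
Proof. by case=> c cP; exists (encode c) => x; rewrite jump_smn. Qed.

Lemma E_total_sets A W : ce_in A W ->
  E (oplus (jump A) (~` jump A)) W /\ E (oplus (jump A) (~` jump A)) (~` W).
Proof.
move=> /ce_in_jump[e eP]; split.
  apply: (@sc_ext _ (fun x => jump A (smn e x))) => [x|]; first by rewrite eP.
  by apply: sc_subst; [exact: E_oplusl|cf].
apply: (@sc_ext _ (fun x => (~` jump A) (smn e x))) => [x|]; first by rewrite /setC /= eP.
by apply: sc_subst; [exact: E_oplusr|cf].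
Qed.

(** * Forcing with rational boxes *)

Lemma ce_in_oracle A f : cfun A f -> ce_in A (fun x => A (f x)) /\ ce_in A (fun x => ~ A (f x)).
Proof.
move=> cf0; have cA : cfun A (fun x => `[< A (f x) >]) by apply: cfun_comp (cfun_oracle A) cf0.
split.
  apply: (@sc_ext _ (fun x => `[< A (f x) >])) => [x|]; last exact: sc_dec.
  by split=> /asboolP.
apply: (@sc_ext _ (fun x => ~~ `[< A (f x) >])) => [x|]; first by split=> /asboolPn.
by apply: sc_dec; cf.
Qed.

(** Cross-multiplication, with subtracted terms moved across so that only natural numbers occur. *)
Definition rle (a b : nat) : bool :=
  nfst (nfst a) * (nsnd b).+1 + nsnd (nfst b) * (nsnd a).+1 <=
  nfst (nfst b) * (nsnd a).+1 + nsnd (nfst a) * (nsnd b).+1.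

Definition rlt (a b : nat) : bool := ~~ rle b a.

Lemma rleE a b : rle a b = (rat_of_code a <= rat_of_code b)%R.
Proof.
rewrite /rle /rat_of_code; move: (nfst _) (nsnd _) (nsnd a) (nfst (nfst b)) (nsnd (nfst b)) (nsnd b).
move=> x y z x' y' z'; rewrite ler_pdivrMr ?ltr0z// mulrAC ler_pdivlMr ?ltr0z//.
rewrite !mulrBl lerBlDr addrAC lerBrDr -!intrM -!intrD ler_int.
by rewrite -!PoszM -!PoszD lez_nat.
Qed.

Lemma rltE a b : rlt a b = (rat_of_code a < rat_of_code b)%R.
Proof. by rewrite /rlt rleE -ltNge. Qed.

Lemma rat_of_code_surj (r : rat) : exists k, rat_of_code k = r.
Proof.
rewrite -(divq_num_den r); have := denq_gt0 r; case: (denq r) => // -[|d] // _.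
case: (numq r) => a.
  by exists (npair (npair a 0) d); rewrite /rat_of_code; npair_simpl; rewrite subr0.
exists (npair (npair 0 a.+1) d); rewrite /rat_of_code; npair_simpl; rewrite sub0r NegzE.
by rewrite mulrNz.
Qed.

Lemma rat_code_dense a b : rlt a b -> exists c, rlt a c /\ rlt c b.
Proof.
rewrite rltE => ab; have [c cE] := rat_of_code_surj ((rat_of_code a + rat_of_code b) / 2)%R.
by exists c; rewrite !rltE cE; have := midf_lt ab => -[-> ->].
Qed.

Lemma cfun_rle A f g : cfun A f -> cfun A g -> cfun A (fun x => rle (f x) (g x)).
Proof. by move=> ? ?; rewrite /rle; cf. Qed.

Lemma cfun_rlt A f g : cfun A f -> cfun A g -> cfun A (fun x => rlt (f x) (g x)).
Proof. by move=> ? ?; apply: cfun_neg; apply: cfun_rle. Qed.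
#[export] Hint Resolve cfun_rle cfun_rlt : cfun.

Lemma rle_refl a : rle a a. Proof. by rewrite rleE. Qed.

Lemma rle_trans b a c : rle a b -> rle b c -> rle a c.
Proof. by rewrite !rleE; exact: le_trans. Qed.

Lemma rltW a b : rlt a b -> rle a b.
Proof. by rewrite rltE rleE; exact: ltW. Qed.

Lemma rle_lt_trans b a c : rle a b -> rlt b c -> rlt a c.
Proof. by rewrite rleE !rltE; exact: le_lt_trans. Qed.

Lemma rlt_le_trans b a c : rlt a b -> rle b c -> rlt a c.
Proof. by rewrite rleE !rltE; exact: lt_le_trans. Qed.

Lemma rlt_irr a : rlt a a = false.
Proof. by rewrite rltE ltxx. Qed.

(* A condition [p] codes the box of R^{n+1} with sides ]lo 0 p, hi 0 p[, ..., ]lo n p, hi n p[. *)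
Definition lo (i p : nat) : nat := seqnth (nfst p) i.
Definition hi (i p : nat) : nat := seqnth (nsnd p) i.

Lemma cfun_lo A f g : cfun A f -> cfun A g -> cfun A (fun x => lo (f x) (g x)).
Proof. by move=> ? ?; rewrite /lo; cf. Qed.

Lemma cfun_hi A f g : cfun A f -> cfun A g -> cfun A (fun x => hi (f x) (g x)).
Proof. by move=> ? ?; rewrite /hi; cf. Qed.
#[export] Hint Resolve cfun_lo cfun_hi : cfun.

Section Forcing.
Variable n : nat.

(** The middle clause requires nonempty sides of [p'], so [ext p p] expresses that [p] is a genuine
    box. *)
Definition ext (p' p : nat) : bool :=
  all (fun i => [&& rle (lo i p) (lo i p'), rlt (lo i p') (hi i p') & rle (hi i p') (hi i p)])
    (iota 0 n.+1).

Lemma extP p' p : reflect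
  (forall i, i <= n -> [/\ rle (lo i p) (lo i p'), rlt (lo i p') (hi i p') & rle (hi i p') (hi i p)])
  (ext p' p).
Proof.
by apply: (iffP (allnP _ _)) => h i /h; [move/and3P|move=> ?; apply/and3P].
Qed.

Lemma cfun_ext_cond A f g : cfun A f -> cfun A g -> cfun A (fun x => ext (f x) (g x)).
Proof.
move=> cf0 cg; apply: (@cfun_all A (fun x i => [&& rle (lo i (g x)) (lo i (f x)),
  rlt (lo i (f x)) (hi i (f x)) & rle (hi i (f x)) (hi i (g x))])); last by cf.
have ? : cfun A (fun k => f (nfst k)) by apply: cfun_comp cf0 _; cf.
have ? : cfun A (fun k => g (nfst k)) by apply: cfun_comp cg _; cf.
by cf.
Qed.
Hint Resolve cfun_ext_cond : cfun.

Lemma ext_trans q p r : ext p q -> ext q r -> ext p r.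
Proof.
move=> /extP pq /extP qr; apply/extP => i ni.
have [a1 a2 a3] := pq i ni; have [b1 b2 b3] := qr i ni.
by split=> //; [exact: rle_trans b1 a1|exact: rle_trans a3 b3].
Qed.

Lemma box_ex (l h : nat -> nat) : exists p, forall i, i <= n -> lo i p = l i /\ hi i p = h i.
Proof.
have [a aP] := seqnth_ex l n.+1; have [b bP] := seqnth_ex h n.+1.
by exists (npair a b) => i ni; rewrite /lo /hi; npair_simpl; rewrite aP ?bP.
Qed.

Definition zero2_set : set nat := oplus (jump (jump set0)) (~` jump (jump set0)).

(** Stage [t] serves the pair of programs coded by [t]: the least code of an extension with a
    witness in [U] but not in [V] is taken if there is one, and otherwise the box is kept. *)
Lemma generic_seq : exists ps : nat -> nat,
  [/\ ext (ps 0) (ps 0), forall s, ext (ps s.+1) (ps s),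
    E zero2_set (fun k => nsnd k = ps (nfst k)) &
    forall U V, ce U -> ce V -> exists s,
      (exists x, U (npair (ps s) x) /\ ~ V (npair (ps s) x)) \/
      (forall p, ext p (ps s) -> forall x, U (npair p x) -> V (npair p x))].
Proof.
pose K := jump set0.
(* [m] codes an extension together with its witness. Through [smn] the relation [good] becomes c.e.
   in [K], as does its projection, so the jump of [K] settles both. *)
pose good t p m := [/\ ext (nfst m) p, K (smn (nfst t) m) & ~ K (smn (nsnd t) m)].
have cgood : ce_in K (fun k => good (nfst k) (nfst (nsnd k)) (nsnd (nsnd k))).
  apply: sc_and3; first by apply: sc_dec; cf.
    by apply: (ce_in_oracle _).1; cf.
  by apply: (ce_in_oracle _).2; cf.
have cex : ce_in K (fun k => exists m, good (nfst k) (nsnd k) m).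
  by apply: sc_ex; apply: (sc_subst3 cgood); cf.
have [Eg Eng] := E_total_sets cgood.
have [Ex Enx] := E_total_sets cex.
pose St t p p' := (exists m, [/\ good t p m, forall i, i < m -> ~ good t p i & p' == nfst m]) \/
  (~ (exists m, good t p m)) /\ p' == p.
have ESt : E zero2_set (fun k => St (nfst k) (nfst (nsnd k)) (nsnd (nsnd k))).
  apply: sc_or.
    apply: sc_ex; apply: sc_and3.
    - by apply: (sc_subst3 Eg); cf.
    - apply: sc_ball; last by cf.
      by apply: (@sc_subst3 _ _ _ (fun t p i => ~ good t p i)) => //; cf.
    - by apply: sc_dec; cf.
  apply: sc_and; last by apply: sc_dec; cf.
  by apply: (@sc_subst2 _ _ _ (fun t p => ~ exists m, good t p m)) => //; cf.
have Sttot t p : exists p', St t p p'.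
  have [[m gm]|ng] := pselect (exists m, good t p m); last by exists p; right.
  have [i /asboolP gi imin] := ex_minnP (ex_intro (fun m => `[< good t p m >]) m (asboolT gm)).
  exists (nfst i); left; exists i; split=> // j ji /asboolP /imin; lia.
have Stfun t p q q' : St t p q -> St t p q' -> q = q'.
  case=> [[m [gm lm /eqP ->]]|[ng /eqP ->]]; case=> [[m' [gm' lm' /eqP ->]]|[ng' /eqP ->]] //.
  - congr nfst; case: (ltngtP m m') => // mm.
      by case: (lm' _ mm).
    by case: (lm _ mm).
  - by case: ng'; exists m.
  - by case: ng; exists m'.
have [f fP] := choice (fun tp => Sttot tp.1 tp.2).
have [one oneE] := rat_of_code_surj 1%R.
have [zero zeroE] := rat_of_code_surj 0%R.
have [p0 p0P] := box_ex (fun=> zero) (fun=> one).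
pose ps := nat_rect (fun=> nat) p0 (fun t p => f (t, p)).
have psS t : St t (ps t) (ps t.+1) by exact: (fP (t, ps t)).
have valid0 : ext p0 p0.
  by apply/extP => i ni; have [-> ->] := p0P i ni; rewrite !rle_refl rltE oneE zeroE ltr01.
have extS s : ext (ps s) (ps s) -> ext (ps s.+1) (ps s).
  by move=> h; case: (psS s) => [[m [[? _ _] _ /eqP ->]]|[_ /eqP ->]].
have valid s : ext (ps s) (ps s).
  elim: s => // s /extS /extP h; apply/extP => i ni; have [_ h2 _] := h i ni.
  by rewrite !rle_refl.
exists ps; split=> //.
- by move=> s; apply: extS.
(* [St] is total and single-valued, so the graph of [ps] is the iteration of a relation already
   known to lie below [zero2_set]. *)
- apply: (@sc_ext _ (fun k => recrel (fun z => z == p0) St (nfst k) (nsnd k))) => [k|].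
    elim: (nfst k) (nsnd k) => [|t IH] z /=; first by split=> /eqP.
    by split=> [[u [/IH -> h]]|->]; [exact: (Stfun t (ps t))|exists (ps t); rewrite IH].
  apply: (@sc_recrel _ _ _ (fun _ z => z == p0) (fun _ => St)); try cf.
    by apply: sc_dec; cf.
  by apply: (sc_subst3 ESt); cf.
- move=> U V [u uP] [v vP]; pose t := npair (encode u) (encode v).
  have UE m : K (smn (nfst t) m) = U m by rewrite /t /K; npair_simpl; apply/propext; rewrite jump_smn uP.
  have VE m : K (smn (nsnd t) m) = V m by rewrite /t /K; npair_simpl; apply/propext; rewrite jump_smn vP.
  have gE p m : good t p m <-> [/\ ext (nfst m) p, U m & ~ V m] by rewrite /good UE VE.
  case: (psS t) => [[m [/gE[h1 h2 h3] _ /eqP e]]|[ng _]].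
    by exists t.+1; left; exists (nsnd m); rewrite e npairK.
  exists t; right=> p ep x Ux; apply: contrapT => nV; apply: ng.
  by exists (npair p x); apply/gE; npair_simpl.
Qed.

End Forcing.

(** * The generic point *)

#[export] Hint Resolve cfun_ext_cond : cfun.

Definition rmax (a b : nat) : nat := if rle a b then b else a.

Lemma rmaxl a b : rle a (rmax a b).
Proof. by rewrite /rmax; case: ifP => // _; apply: rle_refl. Qed.

Lemma rmaxr a b : rle b (rmax a b).
Proof.
rewrite /rmax; case: ifP => [_|/negbT h]; first exact: rle_refl.
by apply: rltW; rewrite /rlt.
Qed.

Lemma rmax_lt a b c : rlt a c -> rlt b c -> rlt (rmax a b) c.
Proof. by rewrite /rmax; case: ifP. Qed.

Section Generic.
Variables (n : nat) (ps : nat -> nat).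
Hypothesis ps0 : ext n (ps 0) (ps 0).
Hypothesis psS : forall s, ext n (ps s.+1) (ps s).
Hypothesis psG : forall U V, ce U -> ce V -> exists s,
  (exists x, U (npair (ps s) x) /\ ~ V (npair (ps s) x)) \/
  (forall p, ext n p (ps s) -> forall x, U (npair p x) -> V (npair p x)).

Local Notation ext := (ext n).

Lemma ext_valid p q : ext p q -> ext p p.
Proof.
move=> /extP h; apply/extP => i ni; have [_ h2 _] := h i ni.
by rewrite !rle_refl.
Qed.

Lemma ps_ext s t : s <= t -> ext (ps t) (ps s).
Proof.
elim: t => [|t IH]; first by rewrite leqn0 => /eqP ->.
by rewrite leq_eqVlt => /orP[/eqP ->|/IH]; [exact: ext_valid (psS t)|exact: ext_trans].
Qed.

(** The first alternative of genericity would be a counterexample on the sequence itself. Only the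
    second one remains, and it persists at later stages. *)
Lemma force U V : ce U -> ce V ->
  (forall s x, U (npair (ps s) x) -> V (npair (ps s) x)) ->
  exists s, forall t, s <= t -> forall p, ext p (ps t) -> forall x, U (npair p x) -> V (npair p x).
Proof.
move=> cU cV UV; have [s [[x [/UV]]//|h]] := psG cU cV.
by exists s => t st p ep; apply: h; apply: ext_trans ep (ps_ext st).
Qed.

Lemma force0 U : ce U -> (forall s x, ~ U (npair (ps s) x)) ->
  exists s, forall t, s <= t -> forall p, ext p (ps t) -> forall x, ~ U (npair p x).
Proof.
move=> cU nU; have [|s x /nU//|s sP] := @force U (fun=> is_true false) cU.
  by apply: sc_dec; cf.
by exists s => t st p ep x /(sP t st p ep).
Qed.

Lemma box_mod p i a b : ext p p -> i <= n ->
  rle (lo i p) a -> rlt a b -> rle b (hi i p) ->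
  exists p', [/\ ext p' p, lo i p' = a & hi i p' = b].
Proof.
move=> /extP pp ni la ab bh.
have [p' pP] := box_ex n (fun j => if j == i then a else lo j p) (fun j => if j == i then b else hi j p).
exists p'; split; [|by have [-> _] := pP i ni; rewrite eqxx|by have [_ ->] := pP i ni; rewrite eqxx].
apply/extP => j nj; have [-> ->] := pP j nj; case: eqP => [->|_] //.
exact: pp.
Qed.

(** Every box has an extension with a larger lower end, so no stage can force the lower ends to stay
    bounded by an old one. Hence [cutL], though defined by the weak [rle], is a strict left cut. *)
Lemma lo_strict i s : i <= n -> exists t, rlt (lo i (ps s)) (lo i (ps t)).
Proof.
move=> ni; apply: contrapT => /forallNP no.
have [|s' x|t tP] := @force0 (fun k => rlt (lo i (ps s)) (lo i (nfst k))).
- by apply: sc_dec; cf.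
- by npair_simpl; exact: no.
have tv := ps_ext (leqnn (maxn s t)).
have /extP/(_ i ni)[_ lh _] := tv.
have [c [lc ch]] := rat_code_dense lh.
have [p [ep pl _]] := box_mod tv ni (rltW lc) ch (rle_refl _).
apply: (tP _ (leq_maxr s t) p ep 0); npair_simpl; rewrite pl.
by apply: rle_lt_trans lc; have /extP/(_ i ni)[] := ps_ext (leq_maxl s t).
Qed.

Lemma hi_strict i s : i <= n -> exists t, rlt (hi i (ps t)) (hi i (ps s)).
Proof.
move=> ni; apply: contrapT => /forallNP no.
have [|s' x|t tP] := @force0 (fun k => rlt (hi i (nfst k)) (hi i (ps s))).
- by apply: sc_dec; cf.
- by npair_simpl; exact: no.
have tv := ps_ext (leqnn (maxn s t)).
have /extP/(_ i ni)[_ lh _] := tv.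
have [c [lc ch]] := rat_code_dense lh.
have [p [ep _ ph]] := box_mod tv ni (rle_refl _) lc (rltW ch).
apply: (tP _ (leq_maxr s t) p ep 0); npair_simpl; rewrite ph.
by apply: rlt_le_trans ch _; have /extP/(_ i ni)[] := ps_ext (leq_maxl s t).
Qed.

(** Every box can be shrunk to one side of [q]; so the generic coordinates are irrational. *)
Lemma ps_decide i q : i <= n -> exists s, rle q (lo i (ps s)) \/ rle (hi i (ps s)) q.
Proof.
move=> ni; apply: contrapT => /forallNP no.
have [|s x /orP|t tP] := @force0 (fun k => rle q (lo i (nfst k)) || rle (hi i (nfst k)) q).
- by apply: sc_dec; cf.
- by npair_simpl; exact: no.
have /not_orP[/negP nl /negP nh] := no t.
have lq : rle (lo i (ps t)) q by apply: rltW.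
have [p [ep pl _]] := box_mod (ps_ext (leqnn t)) ni lq nh (rle_refl _).
by apply: (tP _ (leqnn t) p ep 0); npair_simpl; rewrite pl rle_refl.
Qed.

Lemma lo_hi i s t : i <= n -> rlt (lo i (ps s)) (hi i (ps t)).
Proof.
move=> ni; have /extP/(_ i ni)[h1 _ _] := ps_ext (leq_maxl s t).
have /extP/(_ i ni)[_ h2 h3] := ps_ext (leq_maxr s t).
by apply: rle_lt_trans h1 _; apply: rlt_le_trans h2 h3.
Qed.

Definition cutL (i q : nat) : Prop := exists s, rle q (lo i (ps s)).
Definition cutU (q : nat) : Prop := exists s, rle (hi 0 (ps s)) q.

Lemma cutUE : cutU = ~` cutL 0.
Proof.
apply/predeqP => q; split=> [[s hq] [t ql]|nL].
  by have := rlt_le_trans (lo_hi t s (leq0n n)) (rle_trans hq ql); rewrite rlt_irr.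
by have [s [ql|hq]] := ps_decide q (leq0n n); [case: nL; exists s|exists s].
Qed.

(** An axiom of [Psi] for a [q] above the generic real must use an element of [W], and some stage
    [t] forces this for all smaller boxes. A [q] below the real but inside the side of [ps t] has an
    axiom avoiding [W], yet a box below [ps t] can be given [q] as upper end. *)
Lemma cutL0_not_coce W : ce W -> ~ E (~` W) (cutL 0).
Proof.
move=> cW [Psi [cPsi PsiP]].
pose U k := Psi (nsnd k) /\ rle (hi 0 (nfst k)) (nfst (nsnd k)).
pose V k := exists i, fin_mem (nsnd (nsnd k)) i /\ W i.
have [||s x|t tP] := @force U V.
- by apply: sc_and; [apply: sc_subst => //; cf|apply: sc_dec; cf].
- apply: sc_ex; apply: sc_and; first by apply: sc_dec; cf.
  by apply: sc_subst => //; cf.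
- rewrite /U /V; npair_simpl => -[Px hq]; apply: contrapT => nV.
  have : cutU (nfst x) by exists s.
  rewrite cutUE; apply; apply/PsiP; exists (nsnd x); rewrite npairK; split=> // i xi Wi.
  by apply: nV; exists i.
have [t' lt] := lo_strict t (leq0n n).
have /PsiP[e [Pe eW]] : cutL 0 (lo 0 (ps t')) by exists t'; exact: rle_refl.
have [p [ep _ ph]] := box_mod (ps_ext (leqnn t)) (leq0n n) (rle_refl _) lt
  (rltW (lo_hi t' t (leq0n n))).
have [] := tP _ (leqnn t) p ep (npair (lo 0 (ps t')) e).
  by rewrite /U; npair_simpl; rewrite ph rle_refl.
by move=> i; npair_simpl => -[/eW].
Qed.

(* Tag [0] stands for the upper cut of coordinate [0], tag [i.+1] for the lower cut of
   coordinate [i]. *)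
Definition info (p x : nat) : bool :=
  ((nfst x == 0) && rle (hi 0 p) (nsnd x)) ||
  (0 < nfst x) && (nfst x <= n.+1) && rle (nsnd x) (lo (nfst x).-1 p).

Definition gen_set (x : nat) : Prop := exists s, info (ps s) x.
Definition gen_total (x : nat) : Prop := nfst x <= 1 /\ gen_set x.

Lemma cfun_info A f g : cfun A f -> cfun A g -> cfun A (fun x => info (f x) (g x)).
Proof. by move=> ? ?; rewrite /info; cf. Qed.
Hint Resolve cfun_info : cfun.

Lemma info_mono p q x : ext p q -> info q x -> info p x.
Proof.
move=> /extP pq; rewrite /info; case: (nfst x) => [|i] /=; rewrite ?orbF.
  by have [_ _ h] := pq 0 (leq0n n) => /(rle_trans h).
by rewrite ltnS => /andP[ni]; have [h _ _] := pq i ni; rewrite ni => h'; apply: rle_trans h' h.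
Qed.

Lemma info_ps s t x : s <= t -> info (ps s) x -> info (ps t) x.
Proof. by move=> /ps_ext; apply: info_mono. Qed.

Lemma G_tag0 q : gen_set (npair 0 q) <-> cutU q.
Proof.
have h s : info (ps s) (npair 0 q) = rle (hi 0 (ps s)) q by rewrite /info; npair_simpl; rewrite orbF.
by split=> -[s hs]; exists s; move: hs; rewrite h.
Qed.

Lemma G_tagS i q : i <= n -> gen_set (npair i.+1 q) <-> cutL i q.
Proof.
move=> ni; have h s : info (ps s) (npair i.+1 q) = rle q (lo i (ps s)).
  by rewrite /info; npair_simpl; rewrite /= ltnS ni.
by split=> -[s hs]; exists s; move: hs; rewrite h.
Qed.

Lemma G_tag_le x : gen_set x -> nfst x <= n.+1.
Proof. by case=> s; rewrite /info => /orP[/andP[/eqP ->]|/andP[/andP[]]]. Qed.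



Definition enum (F : set nat) (p x : nat) : Prop :=
  exists e, F (npair x e) /\ forall y, fin_mem e y -> info p y.

Lemma ce_enum F f g : ce F -> cfun set0 f -> cfun set0 g -> ce (fun k => enum F (f k) (g k)).
Proof.
move=> cF cf0 cg; apply: sc_subst2 => //; apply: sc_ex; apply: sc_and.
  by apply: sc_subst => //; cf.
apply: (@sc_fin_sub _ _ _ (fun k i => info (nfst (nfst k)) i)); last by cf.
by apply: sc_dec; cf.
Qed.

Lemma enum_mono F p q x : (forall y, info q y -> info p y) -> enum F q x -> enum F p x.
Proof. by move=> qp [e [h1 h2]]; exists e; split=> // y /h2 /qp. Qed.

Lemma fin_stage (P : nat -> nat -> Prop) e :
  (forall s t x, s <= t -> P s x -> P t x) ->
  (forall x, fin_mem e x -> exists s, P s x) -> exists s, forall x, fin_mem e x -> P s x.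
Proof.
move=> mono aP.
have [|N NP] := @collect (fun x s => fin_mem e x -> P s x) e.
  move=> x _; case: (boolP (fin_mem e x)) => [/aP[s Ps]|_]; last by exists 0.
  by exists s.
exists N => x ex; have [s sN Ps] := NP x (fin_mem_lt ex).
exact: mono _ _ _ (ltnW sN) (Ps ex).
Qed.

Lemma enumG F x : (exists e, F (npair x e) /\ finite_set_of e `<=` gen_set) <->
  exists s, enum F (ps s) x.
Proof.
split=> [[e [Fe eG]]|[s [e [Fe eG]]]]; last first.
  by exists e; split=> // y /eG ?; exists s.
have [|s sP] := @fin_stage (fun s y => info (ps s) y) e _ eG; first by move=> *; apply: info_ps; eassumption.
by exists s, e.
Qed.

Lemma enum_ps F s t x : s <= t -> enum F (ps s) x -> enum F (ps t) x.
Proof. by move=> st; apply: enum_mono => y; apply: info_ps. Qed.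

(* Below a condition forcing consistency, T can be enumerated from the boxes whose side in
   coordinate 0 contains the generic real: such a box has with any stage [ps t] a common
   extension as far as the information of coordinates [1..n] goes. *)
Lemma total_below T : E gen_set T -> E gen_set (~` T) -> E gen_total T.
Proof.
move=> [Phi [cPhi PhiP]] [Psi [cPsi PsiP]].
have [|s x|s sP] := @force0 (fun k => enum Phi (nfst k) (nsnd k) /\ enum Psi (nfst k) (nsnd k)).
- by apply: sc_and; apply: ce_enum => //; cf.
- npair_simpl => -[h1 h2]; have : T x by apply/PhiP/enumG; exists s.
  by have : (~` T) x by apply/PsiP/enumG; exists s.
apply: (@sc_ext _ (fun k => exists p', [/\ ext p' (ps s),
  gen_total (npair 0 (hi 0 p')) /\ gen_total (npair 1 (lo 0 p')) & enum Phi p' k])) => [k|]; last first.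
  apply: sc_ex; apply: sc_and3.
  - by apply: sc_dec; cf.
  - by apply: sc_and; (apply: sc_subst; [exact: E_refl|cf]).
  - by apply: E_ce; apply: ce_enum => //; cf.
split=> [[p' [ep [[_ /G_tag0[a ha]] [_ /(G_tagS _ (leq0n n))[b hb]]] Pk]]|/PhiP/enumG[t Pk]]; last first.
  exists (ps (maxn s t)); split; first exact: (ps_ext (leq_maxl s t)).
    split; split; npair_simpl => //; first by apply/G_tag0; exists (maxn s t); exact: rle_refl.
    by apply/G_tagS => //; exists (maxn s t); exact: rle_refl.
  exact: enum_ps (leq_maxr s t) Pk.
apply: contrapT => /PsiP/enumG[t Qk].
pose u := maxn s (maxn (maxn a b) t).
have us : ext (ps u) (ps s) by apply: ps_ext; rewrite leq_maxl.
(* In coordinate 0 the side of [ps u] lies inside that of [p']. Elsewhere the larger lower end is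
   combined with the old upper end of [ps s]: no information mentions upper ends there, so [q]
   carries the information of both [p'] and [ps t] while possibly extending neither. *)
have [q qP] := box_ex n (fun i => if i == 0 then lo 0 (ps u) else rmax (lo i p') (lo i (ps u)))
  (fun i => if i == 0 then hi 0 (ps u) else hi i (ps s)).
have qs : ext q (ps s).
  apply/extP => i ni; have [-> ->] := qP i ni.
  have /extP/(_ i ni)[h1 h2 h3] := us; have /extP/(_ i ni)[g1 g2 g3] := ep.
  move: h1 h2 h3; case: eqP => [->|_] h1 h2 h3; first by split.
  split; [exact: rle_trans h1 (rmaxr _ _)| |exact: rle_refl].
  by apply: rmax_lt; [exact: rlt_le_trans g2 g3|exact: rlt_le_trans h2 h3].
apply: (sP _ (leqnn s) q qs k); npair_simpl; split.
  apply: enum_mono Pk => y; rewrite /info.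
  case: (nfst y) => [|i] /=; rewrite ?orbF.
    have [_ ->] := qP 0 (leq0n n); apply: rle_trans.
    by apply: rle_trans ha; have /extP/(_ 0 (leq0n n))[] : ext (ps u) (ps a) by apply: ps_ext; lia.
  rewrite ltnS => /andP[ni h]; rewrite ni; have [-> _] := qP i ni.
  case: eqP h => [->|_] h; last exact: rle_trans h (rmaxl _ _).
  apply: rle_trans h _; apply: rle_trans hb _.
  by have /extP/(_ 0 (leq0n n))[] : ext (ps u) (ps b) by apply: ps_ext; lia.
apply: enum_mono Qk => y /(info_ps (_ : t <= u)) h; have {h} := h ltac:(lia).
rewrite /info; case: (nfst y) => [|i] /=; rewrite ?orbF.
  by have [_ ->] := qP 0 (leq0n n).
rewrite ltnS => /andP[ni h]; rewrite ni; have [-> _] := qP i ni.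
by case: eqP h => [->|_] h //; exact: rle_trans h (rmaxr _ _).
Qed.


Lemma total_max (R : nat -> nat -> Prop) N :
  (forall i j, R i j \/ R j i) -> (forall i j k, R i j -> R j k -> R i k) ->
  exists i, 0 < i <= N.+1 /\ forall j, 0 < j <= N.+1 -> R i j.
Proof.
move=> tot tr; elim: N => [|N [i [iN iP]]].
  exists 1; split=> // j j1; have -> : j = 1 by lia.
  by case: (tot 1 1).
have [h|h] := tot i N.+2.
  exists i; split; first by lia.
  move=> j jN; have [->//|jn] := eqVneq j N.+2.
  by apply: iP; lia.
exists N.+2; split; first by lia.
move=> j jN; have [->|jn] := eqVneq j N.+2; first by case: (tot N.+2 N.+2).
by apply: tr h _; apply: iP; lia.
Qed.

Lemma rmax_bound (f : nat -> nat) N a b : rlt a b -> (forall j, j < N -> rlt (f j) b) ->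
  exists c, [/\ rlt c b, rle a c & forall j, j < N -> rle (f j) c].
Proof.
move=> ab; elim: N => [|N IH] fb; first by exists a; split=> //; exact: rle_refl.
have [|c [cb ac fc]] := IH; first by move=> j jN; apply: fb; lia.
exists (rmax c (f N)); split; [by apply: rmax_lt => //; exact: fb|exact: rle_trans ac (rmaxl _ _)|].
move=> j; rewrite ltnS leq_eqVlt => /orP[/eqP ->|/fc h]; first exact: rmaxr.
exact: rle_trans h (rmaxl _ _).
Qed.

(** * Fewer than n semirecursive sets beside coordinate 0 cannot yield the n left cuts *)

Section Pigeonhole.
Variables (ks : seq nat) (y : nat -> set nat) (sel : nat -> nat -> nat -> bool).
Hypothesis size_ks : size ks < n.
Hypothesis sel_comp : forall k, k \in ks -> computable2 (fun u v => sel k u v : nat).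
Hypothesis selP : forall k, k \in ks -> forall u v,
  y k u \/ y k v -> y k (if sel k u v then v else u).
Variables Phi Psi : set nat.
Hypothesis cPhi : ce Phi.
Hypothesis cPsi : ce Psi.
Hypothesis PhiP : forall x, ojoin ks y x <-> exists e, Phi (npair x e) /\ finite_set_of e `<=` gen_set.
Hypothesis PsiP : forall x, gen_set x <->
  exists e, Psi (npair x e) /\ finite_set_of e `<=` oplus gen_total (ojoin ks y).

(** Preferring [b] to [a] in either order of the arguments shows that [b] is in the semirecursive
    set whenever [a] is. Any two elements with the same tag are comparable in this way. *)
Let step a b := (nfst a == nfst b) &&
  (sel (nfst a) (nsnd a) (nsnd b) || ~~ sel (nfst a) (nsnd b) (nsnd a)).

(** The guard restricts tags to [ks] also for boxes off the generic sequence, where [Phi] may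
    enumerate anything. *)
Let Yval p a := nfst a \in ks /\ enum Phi p a.

Let Hval p x := (odd x /\ Yval p x./2) \/ (~~ odd x /\ nfst x./2 <= 1 /\ info p x./2).

(** The output of [Psi] composed with [Phi], run on the information of the box [p] alone. *)
Let theta p x := exists e, Psi (npair x e) /\ forall z, fin_mem e z -> Hval p z.

Lemma Yval_mono p q a : (forall x, info q x -> info p x) -> Yval q a -> Yval p a.
Proof. by move=> qp [h1 h2]; split=> //; exact: enum_mono h2. Qed.

Lemma YvalP a : ojoin ks y a <-> exists s, Yval (ps s) a.
Proof.
split=> [Ya|[s [_ h]]]; last by apply/PhiP/enumG; exists s.
by have /PhiP/enumG[s h] := Ya; exists s; split=> //; case: Ya.
Qed.

Lemma HvalP x : oplus gen_total (ojoin ks y) x <-> exists s, Hval (ps s) x.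
Proof.
rewrite oplusE; split.
  case: ifP => [ox /YvalP[s h]|/negbT ox [h1 [s h2]]]; exists s; first by left.
  by right.
case=> s [[ox h]|[ox [h1 h2]]]; first by rewrite ox; apply/YvalP; exists s.
by rewrite (negbTE ox); split=> //; exists s.
Qed.

Lemma Hval_ps s t x : s <= t -> Hval (ps s) x -> Hval (ps t) x.
Proof.
move=> st [[ox h]|[ox [h1 h2]]]; [left|right]; split=> //.
  by apply: Yval_mono h => z; apply: info_ps.
by split=> //; apply: info_ps h2.
Qed.

Lemma thetaG x : gen_set x <-> exists s, theta (ps s) x.
Proof.
rewrite PsiP; split=> [[e [Pe eH]]|[s [e [Pe eH]]]]; last first.
  by exists e; split=> // z /eH ?; apply/HvalP; exists s.
have [||s sP] := @fin_stage (fun s => Hval (ps s)) e; first exact: Hval_ps.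
  by move=> z /eH /HvalP.
by exists s, e.
Qed.

Lemma stepP s a b : Yval (ps s) a -> step a b -> exists t, Yval (ps t) b.
Proof.
move=> Ya; have [aks ya] : ojoin ks y a by apply/YvalP; exists s.
move=> /andP[/eqP ab h]; apply/YvalP; rewrite /ojoin -ab; split=> //.
case/orP: h => h; first by have := selP aks (or_introl ya : _ \/ y (nfst a) (nsnd b)); rewrite h.
have := selP aks (or_intror ya : y (nfst a) (nsnd b) \/ _).
by rewrite (negbTE h).
Qed.

Lemma ce_Yval f g : cfun set0 f -> cfun set0 g -> ce (fun k => Yval (f k) (g k)).
Proof. by move=> ? ?; apply: sc_and; [apply: sc_dec; cf|exact: ce_enum]. Qed.

Lemma ce_theta f g : cfun set0 f -> cfun set0 g -> ce (fun k => theta (f k) (g k)).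
Proof.
move=> ? ?; apply: sc_subst2 => //; apply: sc_ex; apply: sc_and.
  by apply: sc_subst => //; cf.
apply: (@sc_fin_sub _ _ _ (fun k i => Hval (nfst (nfst k)) i)); last by cf.
apply: sc_or; apply: sc_and; try (by apply: sc_dec; cf); first by apply: ce_Yval; cf.
by apply: sc_and; apply: sc_dec; cf.
Qed.

Lemma ce_step f : cfun set0 f ->
  ce (fun k => nfst (nfst (f k)) \in ks /\ step (nfst (f k)) (nsnd (f k))).
Proof.
move=> cf0.
apply: (@sc_tags _ _ _ ks (fun j k => (nfst (nfst (f k)) == nfst (nsnd (f k))) &&
  (sel j (nsnd (nfst (f k))) (nsnd (nsnd (f k))) ||
   ~~ sel j (nsnd (nsnd (f k))) (nsnd (nfst (f k)))))); last by cf.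
move=> j jks; have cs u v : cfun set0 u -> cfun set0 v -> cfun set0 (fun k => sel j (u k) (v k)).
  move=> cu cv; apply: cfun_ext (cfun_comp (sel_comp jks) (cfun_pair cu cv)) => k.
  by npair_simpl.
apply: sc_dec; apply: cfun_and; first by cf.
by apply: cfun_or; [|apply: cfun_neg]; apply: cs; cf.
Qed.

(** Each clause is true along the generic sequence and hence forced. The extensions [q'] appear
    because a consequence of what one stage shows may be enumerated only at a later stage. *)
Lemma pigeonhole_base : exists p, [/\ ext p p,
  forall q a b, ext q p -> Yval q a -> step a b -> exists2 q', ext q' q & Yval q' b,
  forall q x, ext q p -> info q x -> exists2 q', ext q' q & theta q' x &
  forall q i x, ext q p -> 0 < i <= n -> theta q (npair i.+1 x) -> rlt x (hi i q)].
Proof.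
have [|||s0 s0P] := @force (fun k => Yval (nfst k) (nfst (nsnd k)) /\
    (nfst (nfst (nsnd k)) \in ks /\ step (nfst (nsnd k)) (nsnd (nsnd k))))
  (fun k => exists q', ext q' (nfst k) /\ Yval q' (nsnd (nsnd k))).
- by apply: sc_and; [apply: ce_Yval; cf|apply: ce_step; cf].
- by apply: sc_ex; apply: sc_and; [apply: sc_dec; cf|apply: ce_Yval; cf].
- move=> s x; npair_simpl => -[h1 [h2 h3]]; have [t h4] := stepP h1 h3.
  exists (ps (maxn s t)); split; first exact: (ps_ext (leq_maxl s t)).
  by apply: Yval_mono h4 => z; apply: info_ps; exact: leq_maxr.
have [|||s1 s1P] := @force (fun k => info (nfst k) (nsnd k))
  (fun k => exists q', ext q' (nfst k) /\ theta q' (nsnd k)).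
- by apply: sc_dec; cf.
- by apply: sc_ex; apply: sc_and; [apply: sc_dec; cf|apply: ce_theta; cf].
- move=> s x; npair_simpl => ix; have /thetaG[t [e [Pe eH]]] : gen_set x by exists s.
  exists (ps (maxn s t)); split; first exact: (ps_ext (leq_maxl s t)).
  by exists e; split=> // z /eH; apply: Hval_ps; exact: leq_maxr.
have [||s2 s2P] := @force0 (fun k => theta (nfst k) (nsnd k) /\
  (1 < nfst (nsnd k)) && (nfst (nsnd k) <= n.+1) &&
  rle (hi (nfst (nsnd k)).-1 (nfst k)) (nsnd (nsnd k))).
- by apply: sc_and; [apply: ce_theta; cf|apply: sc_dec; cf].
- move=> s x; npair_simpl => -[tx /andP[/andP[x1 xn] hx]].
  have /thetaG : exists s, theta (ps s) x by exists s.
  move=> Gx; have : gen_set (npair (nfst x).-1.+1 (nsnd x)) by rewrite prednK ?npairK//; lia.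
  case/G_tagS => [|t xt]; first by lia.
  have : rlt (lo (nfst x).-1 (ps t)) (hi (nfst x).-1 (ps s)) by apply: lo_hi; lia.
  by move=> /rlt_le_trans/(_ (rle_trans hx xt)); rewrite rlt_irr.
pose u := maxn s0 (maxn s1 s2).
have [u0 [u1 u2]] : s0 <= u /\ s1 <= u /\ s2 <= u by rewrite /u; lia.
exists (ps u); split; first exact: ps_ext.
- move=> q a b qu Ya ab; have := s0P u u0 q qu (npair a b); npair_simpl.
  case; first by split=> //; split=> //; case: Ya.
  by move=> q' [? ?]; exists q'.
- move=> q x qu ix; have := s1P u u1 q qu x; npair_simpl.
  by case=> // q' [? ?]; exists q'.
- move=> q i x qu /andP[i0 ni] tx; apply/negP => hx.
  have := s2P u u2 q qu (npair i.+1 x); npair_simpl; apply; split=> //.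
  by rewrite ltnS i0 ltnS ni.
Qed.

(** [step] need not be transitive; its closure is a total preorder on each tag. *)
Inductive reach (a : nat) : nat -> Prop :=
| reach_refl : reach a a
| reach_step b c : reach a b -> step b c -> reach a c.

Lemma reach_trans a b c : reach a b -> reach b c -> reach a c.
Proof. by move=> ab; elim=> // c' d _ ac cd; exact: reach_step cd. Qed.

Lemma reach_total a b : nfst a = nfst b -> reach a b \/ reach b a.
Proof.
move=> ab; have [h|] := boolP (step a b); first by left; apply: reach_step h; exact: reach_refl.
rewrite /step ab eqxx /= => /norP[h1 /negPn h2]; right.
by apply: (reach_step (reach_refl b)); rewrite /step ab eqxx h2.
Qed.

(* In the box of [p], for each [j] in [1..n] take a condition [P j] whose real has coordinate [j]
   above a rational [m j] and the other coordinates [i >= 1] below [m i], and which makes the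
   composed reduction output [m j < x_j]. As [size ks < n], some [i0] has, on each of the sets
   [y k], its information implied by that of another [P j]. A condition lying above all the
   [P j] with [j != i0] but below [m i0] in coordinate [i0] then forces the false output
   [m i0 < x_i0]. *)
Lemma pigeonhole : False.
Proof.
have [p [pp Hstep Htheta Herr]] := pigeonhole_base.
have midP i : exists m, i <= n -> rlt (lo i p) m /\ rlt m (hi i p).
  case: (leqP i n) => [ni|_]; last by exists 0.
  have /extP/(_ i ni)[_ lh _] := pp.
  by have [c h] := rat_code_dense lh; exists c.
have {midP}[m mP] := choice midP.
(* The conditions are built one inside another in coordinate 0 only: the side of [r] there lies
   inside those of all [P l], so their information with tags 0 and 1 holds jointly. *)
have chain j : j <= n -> exists (P : nat -> nat) r, ext r p /\
    forall l, 0 < l <= j -> [/\ ext (P l) p,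
      rle (lo 0 (P l)) (lo 0 r) /\ rle (hi 0 r) (hi 0 (P l)),
      forall i, 0 < i <= n -> i != l -> rle (hi i (P l)) (m i) &
      theta (P l) (npair l.+1 (m l))].
  elim: j => [_|j IH jn]; first by exists id, p; split=> // l; lia.
  have [P [r [rp PP]]] := IH (ltnW jn).
  (* With [m j.+1] as lower end in coordinate [j.+1], this bound is information of the box, so
     [Htheta] gives an extension that outputs it. *)
  have [b bP] := box_ex n
    (fun i => if i == 0 then lo 0 r else if i == j.+1 then m i else lo i p)
    (fun i => if i == 0 then hi 0 r else if i == j.+1 then hi i p else m i).
  have bp : ext b p.
    apply/extP => i ni; have [-> ->] := bP i ni.
    have /extP/(_ i ni)[h1 h2 h3] := rp.
    have [g1 g2] := mP i ni.
    case: (i =P 0) h1 h2 h3 => [-> //|_ _ _ _].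
    by case: ifP => _; split=> //; try exact: rle_refl; exact: rltW.
  have [|P' P'b tP'] := Htheta b (npair j.+2 (m j.+1)) bp.
    by rewrite /info; npair_simpl; have [-> _] := bP j.+1 jn; rewrite /= eqxx rle_refl ltnS jn.
  have P'p := ext_trans P'b bp.
  exists (fun l => if l == j.+1 then P' else P l), P'; split=> // l lj.
  have /extP/(_ 0 (leq0n n))[c1 c2 c3] := P'b.
  have [e1 e2] := bP 0 (leq0n n); rewrite e1 in c1; rewrite e2 in c3.
  case: eqP => [->|lj1].
    split=> //; first by split; exact: rle_refl.
    move=> i /andP[i0 ni] ij; have /extP/(_ i ni)[_ _] := P'b.
    by have [_ ->] := bP i ni; rewrite (negbTE ij) (gtn_eqF i0).
  have [|h1 [h2 h2'] h3 h4] := PP l; first by lia.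
  by split=> //; split; [exact: rle_trans h2 c1|exact: rle_trans c3 h2'].
have {chain}[P [r [rp PP]]] := chain n (leqnn n).
(* For each tag the conditions are compared by how far their information about [y k] reaches. This
   is a total preorder, and [jm k] will be a top element. *)
pose dom k i j := forall b, Yval (P j) b -> nfst b = k ->
  exists a, [/\ Yval (P i) a, nfst a = k & reach a b].
have domtot k i j : dom k i j \/ dom k j i.
  have [|/existsNP[b /not_implyP[Yb /not_implyP[bk nb]]]] := pselect (dom k i j); first by left.
  right=> c Yc ck; exists b; split=> //.
  have [|//|h] := @reach_total b c; first by rewrite bk ck.
  by case: nb; exists c.
have domtr k i j l : dom k i j -> dom k j l -> dom k i l.
  move=> ij jl c /jl h /h[b [/ij h' /h'[a [Ya ak ab]] bc]].
  by exists a; split=> //; exact: reach_trans bc.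
have n0 : 0 < n by lia.
have jmP k : exists i, 0 < i <= n /\ forall j, 0 < j <= n -> dom k i j.
  have := total_max n.-1 (domtot k) (domtr k).
  by rewrite prednK.
have {jmP}[jm jmP] := choice jmP.
have [i0 i0n i0jm] : exists2 i0, 0 < i0 <= n & i0 \notin map jm ks.
  apply: contrapT => no.
  have : size (iota 1 n) <= size (map jm ks).
    apply: uniq_leq_size (iota_uniq _ _) _ => i; rewrite mem_iota => ii.
    by apply: contrapT => /negP nI; apply: no; exists i => //; lia.
  by rewrite size_iota size_map; lia.
have i0n' : i0 <= n by case/andP: i0n.
(* With [m i0] as upper end in coordinate [i0], the lower end of every other [P j] still fits below,
   whereas the output of [P i0] becomes false. *)
pose b i := if i == i0 then m i else hi i p.
have bh i : i <= n -> rle (b i) (hi i p).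
  move=> ni; rewrite /b; case: ifP => _; last exact: rle_refl.
  by apply: rltW; case: (mP i ni).
have lowP i : exists c, 0 < i <= n -> [/\ rlt c (b i), rle (lo i p) c &
    forall j, 0 < j <= n -> j != i0 -> rle (lo i (P j)) c].
  case: (boolP (0 < i <= n)) => [ii|_]; last by exists 0.
  have ni : i <= n by case/andP: ii.
  have [m1 m2] := mP i ni.
  have lb : rlt (lo i p) (b i).
    by rewrite /b; case: ifP => _ //; exact: rlt_le_trans m1 (rltW m2).
  pose f j := if (0 < j) && (j != i0) then lo i (P j) else lo i p.
  have [|c [c1 c2 c3]] := @rmax_bound f n.+1 _ _ lb.
    move=> j; rewrite ltnS /f => jn; case: ifP => // /andP[j0 ji0].
    have [|h1 _ h3 _] := PP j; first by lia.
    have /extP/(_ i ni)[_ g2 g3] := h1.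
    rewrite /b; case: eqP => [ie|_]; last exact: rlt_le_trans g2 g3.
    by apply: rlt_le_trans g2 _; apply: h3 => //; rewrite ie eq_sym.
  exists c => _; split=> // j /andP[j0 jn] ji0.
  by have := c3 j; rewrite /f j0 ji0 ltnS; apply.
have {lowP}[low lowP] := choice lowP.
have [q qP] := box_ex n (fun i => if i == 0 then lo 0 r else low i)
  (fun i => if i == 0 then hi 0 r else b i).
have qp : ext q p.
  apply/extP => i ni; have [-> ->] := qP i ni.
  have /extP/(_ i ni)[h1 h2 h3] := rp.
  case: eqP h1 h2 h3 => [->//|/eqP i1 _ _ _].
  by have [|g1 g2 _] := lowP i; [lia|split=> //; exact: bh].
have infq j x : 0 < j <= n -> (j != i0 \/ nfst x <= 1) -> info (P j) x -> info q x.
  move=> jj jx; have [_ [h1 h2] _ _] := PP j jj; rewrite /info.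
  case: (nfst x) jx => [|i] jx /=; rewrite ?orbF.
    by have [_ ->] := qP 0 (leq0n n); exact: rle_trans h2.
  rewrite !ltnS => /andP[ni h]; rewrite ni; have [-> _] := qP i ni.
  case: (i =P 0) h => [->|/eqP i1] h; first exact: rle_trans h h1.
  have {jx}ji0 : j != i0 by case: jx => //; rewrite ltnS leqn0 (negbTE i1).
  by have [|_ _ g] := lowP i; [lia|exact: rle_trans h (g j jj ji0)].
(* Each [step] may need a further extension, so a path is followed by shrinking the box
   repeatedly. *)
have forced a c : reach a c -> Yval q a -> forall q', ext q' q -> exists2 q'', ext q'' q' & Yval q'' c.
  move=> ac Ya; elim: ac => [q' q'q|c' d _ IH cd q' q'q].
    by exists q'; [exact: ext_valid q'q|apply: Yval_mono Ya => z; exact: info_mono].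
  have [q1 q1q' Yc] := IH q' q'q.
  have [q2 q2q1 Yd] := Hstep q1 c' d (ext_trans q1q' (ext_trans q'q qp)) Yc cd.
  by exists q2 => //; exact: ext_trans q2q1 q1q'.
have [_ _ _ [e [Pe eH]]] := PP i0 i0n.
(* The finitely many queries of the axiom used by [P i0] are satisfied one by one. Those on
   coordinate 0 hold in the common side; one on [y k] follows from the information of [P (jm k)],
   where [jm k != i0]. *)
have [q' q'q q'H] : exists2 q', ext q' q & forall z, z < e -> fin_mem e z -> Hval q' z.
  elim: {1}e => [|N [q' q'q q'H]]; first by exists q; [exact: ext_valid qp|].
  have HN q'' : ext q'' q' -> (fin_mem e N -> Hval q'' N) ->
      forall z, z < N.+1 -> fin_mem e z -> Hval q'' z.
    move=> q''q' HN z; rewrite ltnS leq_eqVlt => /orP[/eqP -> //|zN ez].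
    case: (q'H z zN ez) => [[oz h]|[oz [h1 h2]]]; [left|right]; split=> //.
      by apply: Yval_mono h => x; exact: info_mono.
    by split=> //; exact: info_mono h2.
  case: (boolP (fin_mem e N)) => [eN|eN]; last first.
    exists q' => //; apply: HN; first exact: ext_valid q'q.
    by move=> eN'; rewrite eN' in eN.
  case: (eH N eN) => [[oN YN]|[oN [N1 iN]]]; last first.
    exists q' => //; apply: HN => [|_]; first exact: ext_valid q'q.
    right; split=> //; split=> //; apply: info_mono q'q _.
    by apply: infq i0n _ iN; right.
  have [jj jdom] := jmP (nfst N./2).
  have Nks : nfst N./2 \in ks by case: YN.
  have ji0 : jm (nfst N./2) != i0.
    by apply: contraNneq i0jm => <-; exact: map_f.
  have [a [Ya _ aN]] := jdom i0 i0n _ YN erefl.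
  have Yqa : Yval q a by apply: Yval_mono Ya => z; apply: infq jj _; left.
  have [q'' q''q' Y''] := forced _ _ aN Yqa q' q'q.
  by exists q''; [exact: ext_trans q''q' q'q|apply: HN => // _; left].
have tq' : theta q' (npair i0.+1 (m i0)).
  by exists e; split=> // z ez; exact: q'H (fin_mem_lt ez) ez.
have := Herr q' i0 _ (ext_trans q'q qp) i0n tq'.
have /extP/(_ i0 i0n')[_ _] := q'q; have [_ ->] := qP i0 i0n'.
have i00 : 0 < i0 by case/andP: i0n.
rewrite /b eqxx (gtn_eqF i00).
by move=> h /rlt_le_trans/(_ h); rewrite rlt_irr.
Qed.

End Pigeonhole.


(** * The degree of the generic point *)

Lemma G_pair x : gen_set x = gen_set (npair (nfst x) (nsnd x)).
Proof. by rewrite npairK. Qed.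

Let cuts (k : nat) : set nat := if k is i.+1 then cutL i else cutU.

Lemma E_gen_set X : E X gen_set <-> E X cutU /\ forall i, i <= n -> E X (cutL i).
Proof.
have -> : gen_set = ojoin (iota 0 n.+2) cuts.
  apply/predeqP => x; rewrite /ojoin mem_iota G_pair /cuts.
  have := @G_tag_le x; rewrite G_pair.
  case: (nfst x) => [_|i ni]; first by rewrite G_tag0; split=> [|[]].
  split=> [Gx|[ni' h]]; last by apply/G_tagS.
  by split; [exact: ni|apply/(G_tagS _ (ni Gx))].
rewrite E_ojoin; split=> [h|[hU hL] [|i]]; last 2 first.
- by move=> _; exact: hU.
- by rewrite mem_iota => ni; exact: hL.
by split=> [|i ni]; [apply: (h 0)|apply: (h i.+1)]; rewrite mem_iota.
Qed.

Lemma E_gen_total X : E X gen_total <-> E X cutU /\ E X (cutL 0).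
Proof.
have -> : gen_total = ojoin [:: 0; 1] cuts.
  apply/predeqP => x; rewrite /gen_total /ojoin G_pair /cuts.
  case: (nfst x) => [|[|i]]; first by rewrite G_tag0; split=> -[].
    by rewrite G_tagS //; split=> -[].
  by split=> -[].
rewrite E_ojoin; split=> [h|[hU hL] k]; first by split; [apply: (h 0)|apply: (h 1)].
by rewrite !inE => /orP[/eqP ->|/eqP ->].
Qed.

(** The two cuts of coordinate 0 are complementary, so complementation exchanges the roles of tags 0
    and 1; all larger tags belong to the complement. *)
Lemma gen_total_total : E gen_total (~` gen_total).
Proof.
have /E_gen_total[hU hL] := E_refl gen_total.
apply: (@sc_ext _ (fun x => 1 < nfst x \/ ((nfst x == 0 /\ cutL 0 (nsnd x)) \/
  (nfst x == 1 /\ cutU (nsnd x))))) => [x|]; last first.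
  apply: sc_or; first by apply: sc_dec; cf.
  by apply: sc_or; apply: sc_and; try (by apply: sc_dec; cf); apply: sc_subst => //; cf.
rewrite /gen_total /setC /= G_pair; case: (nfst x) => [|[|i]] /=.
- rewrite G_tag0 cutUE; split=> [[//|[[_ h] [_]|[]//]]|h]; first exact.
  by right; left; split=> //; apply: contrapT => nL; apply: h.
- rewrite G_tagS // cutUE; split=> [[//|[[]//|[_ h] [_ L]]]|h]; first exact: h.
  by right; right; split=> // L; apply: h.
- by split=> [_ [] //|_]; left.
Qed.

Lemma G_not_ojoin (y : nat -> set nat) : (forall k, semirecursive_set (y k)) ->
  E (ojoin (iota 0 n.+1) y) gen_set -> E gen_set (ojoin (iota 0 n.+1) y) -> False.
Proof.
move=> ssr yG Gy; have /E_gen_set[GU GL] := E_refl gen_set.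
have yT : E (ojoin (iota 0 n.+1) y) (cutL 0) by apply: E_trans yG (GL _ _).
have ynT : E (ojoin (iota 0 n.+1) y) (~` cutL 0) by rewrite -cutUE; apply: E_trans yG GU.
have [I [sI IT Imin]] := min_support (fun k _ => ssr k) yT ynT.
have GyI i : i \in I -> E gen_set (y i) by move=> /sI; move/E_ojoin: Gy; apply.
have [[i [i' [iI iI' ii']]]|allI] := pselect (exists i i', [/\ i \in I, i' \in I & i != i']).
  have Dy j : j \in I -> E gen_total (y j).
    move=> jI; apply: total_below; first exact: GyI.
    apply: E_trans (Imin j jI); apply/E_ojoin => k; rewrite mem_filter => /andP[_]; exact: GyI.
  pose K := [seq k <- iota 0 n.+1 | (k != i) && (k != i')].
  have szK : size K < n.
    have : size [:: i, i' & K] <= size (iota 0 n.+1).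
      apply: uniq_leq_size.
        rewrite /= filter_uniq ?iota_uniq // andbT inE negb_or ii' /=.
        by rewrite !mem_filter !eqxx /= andbF.
      move=> k; rewrite !inE => /or3P[/eqP ->|/eqP ->|]; try exact: sI.
      by rewrite mem_filter => /andP[].
    by rewrite size_iota /=; lia.
  have GK : E gen_set (ojoin K y).
    apply/E_ojoin => k; rewrite mem_filter => /andP[_ kI].
    by move/E_ojoin: Gy; apply.
  have KG : E (oplus gen_total (ojoin K y)) gen_set.
    apply: E_trans yG; apply/E_ojoin => k kI.
    have [->|ki] := eqVneq k i; first exact: E_trans (E_oplusl _ _) (Dy i iI).
    have [->|ki'] := eqVneq k i'; first exact: E_trans (E_oplusl _ _) (Dy i' iI').
    apply: E_trans (E_oplusr _ _) _; move/E_ojoin: (E_refl (ojoin K y)); apply.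
    by rewrite mem_filter ki ki'.
  have [sel selP] := choice ssr.
  have [Phi [cPhi PhiP]] := GK; have [Psi [cPsi PsiP]] := KG.
  exact: (@pigeonhole K y sel szK (fun k _ => (selP k).1) (fun k _ => (selP k).2)
    Phi Psi cPhi cPsi PhiP PsiP).
case eI : I => [|i I'].
  (* An empty [I] would make [cutL 0] c.e.; the complement of [setT] brings this case under the same
     lemma. *)
  apply: (@cutL0_not_coce setT); first by apply: (@sc_ext _ (fun=> true)) => //; apply: sc_dec; cf.
  by apply: E_trans IT; rewrite eI; apply/E_ojoin.
have iI : i \in I by rewrite eI inE eqxx.
have allIi k : k \in I -> k = i.
  by move=> kI; apply/eqP; apply: contrapT => /negP ki; apply: allI; exists k, i.
(* Here [i] is the only member of [I], so minimality reduces the complement of [y i] to an empty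
   join, which makes it c.e. *)
apply: (@cutL0_not_coce (~` y i)).
  apply: E_set0_ce; apply: E_trans (Imin i iI); apply/E_ojoin => k.
  by rewrite mem_filter => /andP[/eqP ki /allIi].
rewrite setCK; apply: E_trans IT; apply/E_ojoin => k /allIi ->; exact: E_refl.
Qed.

Lemma E_zero2_G : E zero2_set (fun k => nsnd k = ps (nfst k)) -> E zero2_set gen_set.
Proof.
move=> Eps; apply: (@sc_ext _ (fun x => exists s p, p = ps s /\ info p x)) => [x|].
  by split=> [[s [p [-> h]]]|[s h]]; exists s => //; exists (ps s).
apply: sc_ex; apply: sc_ex; apply: sc_and; last by apply: sc_dec; cf.
by apply: (@sc_subst2 _ _ _ (fun s p => p = ps s)) => //; cf.
Qed.

End Generic.

(** * Degrees and spaces *)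

Lemma edeg_eqP A B : edeg A = edeg B <-> E A B /\ E B A.
Proof.
split=> [e|[AB BA]].
  have : edeg B B by split; exact: E_refl.
  by rewrite -e => -[].
apply/predeqP => C; split=> -[h1 h2]; split.
- exact: (E_trans h1 AB).
- exact: (E_trans BA h2).
- exact: (E_trans h1 BA).
- exact: (E_trans AB h2).
Qed.

Lemma edeg_refl A : edeg A A.
Proof. by split; exact: E_refl. Qed.

Lemma edeg_mem A B : edeg A B -> edeg A = edeg B.
Proof. by move=> [h1 h2]; apply/edeg_eqP. Qed.

Lemma edeg_joinE A B : edeg_join (edeg A) (edeg B) = edeg (oplus A B).
Proof.
apply/predeqP => C; split=> [[A' [B' [/edeg_mem/edeg_eqP[h1 h2] /edeg_mem/edeg_eqP[h3 h4]]]]|h].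
  move=> /edeg_mem/edeg_eqP[h5 h6].
  rewrite (_ : edeg (oplus A B) = edeg C); first exact: edeg_refl.
  apply/edeg_eqP; split.
    apply: (fun h => E_trans h h5); apply/E_oplus; split.
      exact: E_trans (E_oplusl _ _) h1.
    exact: E_trans (E_oplusr _ _) h3.
  apply: (E_trans h6); apply/E_oplus; split.
    exact: E_trans (E_oplusl _ _) h2.
  exact: E_trans (E_oplusr _ _) h4.
by exists A, B; split=> //; exact: edeg_refl.
Qed.

(** The join is described by its upper bounds, which determine its degree independently of how
    finite joins are coded. *)
Lemma big_edeg_join n (y : 'I_n -> set nat) : exists C,
  \big[edeg_join/edeg set0]_(i < n) edeg (y i) = edeg C /\
  forall X, E X C <-> forall i, E X (y i).
Proof.
elim: n y => [|n IH] y.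
  exists set0; rewrite big_ord0; split=> // X; split=> [_ [] //|_].
  exact: E_set0.
have [C [CE CP]] := IH (fun i => y (lift ord0 i)).
exists (oplus (y ord0) C); rewrite big_ord_recl CE edeg_joinE; split=> // X.
rewrite E_oplus CP; split=> [[h1 h2] i|h]; last by split=> [|i]; exact: h.
by have [j ->|->] := unliftP ord0 i.
Qed.

Lemma semirecursive_edegreeE a : semirecursive_edegree a <->
  exists2 y, a = edeg y & semirecursive_set y.
Proof.
split=> [[[A ->] [y [/edeg_mem -> sy]]]|[y -> sy]]; first by exists y.
by split; [exists y|exists y; split=> //; exact: edeg_refl].
Qed.

Lemma n_semirecursiveE n a : n_semirecursive_edegree n a <->
  exists y : 'I_n -> set nat, (forall i, semirecursive_set (y i)) /\
    a = \big[edeg_join/edeg set0]_(i < n) edeg (y i).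
Proof.
split=> [[s [sP ->]]|[y [yP ->]]]; last first.
  by exists (fun i => edeg (y i)); split=> // i; apply/semirecursive_edegreeE; exists (y i).
have /choice[y yP] : forall i, exists y, s i = edeg y /\ semirecursive_set y.
  by move=> i; have /semirecursive_edegreeE[y h1 h2] := sP i; exists y.
exists y; split=> [i|]; first by case: (yP i).
by apply: eq_bigr => i _; case: (yP i).
Qed.

(** The selector returns the smaller rational. *)
Lemma down_semirecursive (A : set nat) :
  (forall a b, rle a b -> A b -> A a) -> semirecursive_set A.
Proof.
move=> dA; exists (fun a b => rle b a); split.
  rewrite /computable2; change (cfun set0 (fun k => rle (nsnd k) (nfst k))); cf.
move=> a b; case: ifP => [ba [/(dA _ _ ba)|]//|/negbT ab [//|]].
by apply: dA; apply: rltW.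
Qed.

Section Spaces.
Variable R : realType.

Lemma lower_semirecursive (x : lower_reals R) : semirecursive_set (nbase x).
Proof.
apply: down_semirecursive => a b; rewrite rleE /nbase /= => ab.
by apply: le_lt_trans; rewrite ler_rat.
Qed.

Lemma nbase_power n (v : power_space (lower_reals R) n) : exists y : nat -> set nat,
  (forall k, semirecursive_set (y k)) /\
  forall X, E X (nbase v) <-> forall k, k < n -> E X (y k).
Proof.
elim: n v => [|n IH] v.
  exists (fun=> set0); split; first by move=> _; exact: down_semirecursive.
  by move=> X; split=> // _; exact: E_set0.
case: v => x v; have [y [ys yP]] := IH v.
exists (fun k => if k is k'.+1 then y k' else nbase x); split.
  by case=> [|k]; [exact: lower_semirecursive|exact: ys].
move=> X; rewrite /= nbase_prod E_oplus yP; split=> [[h1 h2] [|k]|h]; first by [].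
  exact: h2.
by split; [exact: (h 0)|move=> k kn; exact: (h k.+1)].
Qed.

Lemma power_point n (x : nat -> lower_reals R) : exists v : power_space (lower_reals R) n,
  forall X, E X (nbase v) <-> forall k, k < n -> E X (nbase (x k)).
Proof.
elim: n x => [|n IH] x.
  by exists tt => X; split=> // _; exact: E_set0.
have [v vP] := IH (fun k => x k.+1).
exists (x 0, v) => X; rewrite /= nbase_prod E_oplus vP; split=> [[h1 h2] [|k]|h]; first by [].
  exact: h2.
by split; [exact: (h 0)|move=> k kn; exact: (h k.+1)].
Qed.

(** * The generic sequence as a point of the product space *)

Section Reals.
Variables (n : nat) (ps : nat -> nat).
Hypothesis ps0 : ext n (ps 0) (ps 0).
Hypothesis psS : forall s, ext n (ps s.+1) (ps s).
Hypothesis psG : forall U V, ce U -> ce V -> exists s,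
  (exists x, U (npair (ps s) x) /\ ~ V (npair (ps s) x)) \/
  (forall p, ext n p (ps s) -> forall x, U (npair p x) -> V (npair p x)).

Let val (q : nat) : R := ratr (rat_of_code q).
Let real (i : nat) : R := sup [set val (lo i (ps s)) | s in [set: nat]].

Lemma real_ubound i t : i <= n ->
  ubound [set val (lo i (ps s)) | s in [set: nat]] (val (hi i (ps t))).
Proof.
move=> ni _ [s _ <-]; rewrite ler_rat -rleE; apply: rltW.
exact: (lo_hi ps0 psS s t ni).
Qed.

Lemma real_has_sup i : i <= n -> has_sup [set val (lo i (ps s)) | s in [set: nat]].
Proof.
move=> ni; split; first by exists (val (lo i (ps 0))), 0.
by exists (val (hi i (ps 0))); exact: real_ubound.
Qed.

Lemma real_cutL i q : i <= n -> (val q < real i)%R <-> cutL ps i q.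
Proof.
move=> ni; split=> [qi|[s qs]].
  have e0 : (0 < real i - val q)%R by rewrite subr_gt0.
  have [_ [s _ <-]] := sup_adherent e0 (real_has_sup ni).
  rewrite -/(real i) opprB addrCA subrr addr0 ltr_rat => /ltW.
  by rewrite -rleE; exists s.
have [t st] := lo_strict ps0 psS psG s ni.
have : (val q < val (lo i (ps t)))%R by rewrite ltr_rat -rltE; apply: rle_lt_trans qs st.
move=> /lt_le_trans; apply.
by apply: ub_le_sup; [by case: (real_has_sup ni)|exists t].
Qed.

Lemma real_cutU q : (real 0 < val q)%R <-> cutU ps q.
Proof.
split=> [rq|[s sq]].
  rewrite (cutUE ps0 psS psG) => /(real_cutL _ (leq0n n)).
  by move=> /(lt_trans rq); rewrite ltxx.
have [t ts] := hi_strict ps0 psS psG s (leq0n n).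
have : (real 0 <= val (hi 0 (ps t)))%R.
  apply: ge_sup; first by case: (real_has_sup (leq0n n)).
  exact: real_ubound.
move=> /le_lt_trans; apply; rewrite ltr_rat -rltE.
exact: rlt_le_trans ts sq.
Qed.

Lemma generic_point : exists v : prod_space (euclidean_reals R) (power_space (lower_reals R) n),
  forall X, E X (nbase v) <-> E X (gen_set n ps).
Proof.
have [v vP] := power_point n (fun k => real k.+1 : lower_reals R).
exists (real 0, v) => X; rewrite nbase_prod E_oplus vP E_gen_set.
(* Projecting the intervals around the real to one end point recovers each cut; an end of [ps 0]
   supplies the other end point. *)
pose B : set nat := fun e => cutL ps 0 (nfst e) /\ cutU ps (nsnd e).
have -> : nbase (real 0 : euclidean_reals R) = B.
  apply/predeqP => e; rewrite /nbase /B /= -(real_cutL _ (leq0n n)) -real_cutU.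
  by split=> [/andP|[-> ->]].
have nL k : k.+1 <= n -> nbase (real k.+1 : lower_reals R) = cutL ps k.+1.
  by move=> kn; apply/predeqP => q; rewrite /nbase /= -(real_cutL _ kn).
have BL : E B (cutL ps 0).
  apply: (@sc_ext _ (fun q => exists h, B (npair q h))) => [q|].
    rewrite /B; split=> [[h]|Lq]; npair_simpl; first by case.
    by exists (hi 0 (ps 0)); npair_simpl; split=> //; exists 0; exact: rle_refl.
  by apply: sc_ex; apply: sc_subst; [exact: E_refl|cf].
have BU : E B (cutU ps).
  apply: (@sc_ext _ (fun q => exists l, B (npair l q))) => [q|].
    rewrite /B; split=> [[h]|Lq]; npair_simpl; first by case.
    by exists (lo 0 (ps 0)); npair_simpl; split=> //; exists 0; exact: rle_refl.
  by apply: sc_ex; apply: sc_subst; [exact: E_refl|cf].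
split=> [[XB h]|[XU XL]]; split.
- exact: E_trans XB BU.
- case=> [_|i ni]; first exact: E_trans XB BL.
  by rewrite -nL //; exact: h.
- by apply: sc_and; [apply: sc_subst (XL 0 _) _|apply: sc_subst XU _] => //; cf.
- by move=> k kn; rewrite nL //; exact: XL.
Qed.

End Reals.
End Spaces.

Theorem theorem7p19 (R : realType) (n : nat) :
  (exists c d : set (set nat),
     [/\ n_semirecursive_edegree n c,
         edeg_le c zero_jump2,
         total_edegree d,
         edeg_le d zero_jump2
       & ~ n_semirecursive_edegree n.+1 (edeg_join c d)]) /\
  ~ (degree_spectrum (prod_space (euclidean_reals R)
                                 (power_space (lower_reals R) n))
       `<=` degree_spectrum (power_space (lower_reals R) n.+1)).
Proof.
have [ps [ps0 psS Eps psG]] := generic_seq n.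
have GE := @E_gen_set n ps.
(* Stated through upper bounds, this covers both a join of n+1 semirecursive degrees and the
   neighborhood filter of a point of the power space. *)
have not_lub (y : nat -> set nat) : (forall k, semirecursive_set (y k)) ->
    ~ forall X, E X (gen_set n ps) <-> forall k, k < n.+1 -> E X (y k).
  move=> ys yP; apply: (G_not_ojoin ps0 psS psG ys).
    apply/yP => k kn; move/E_ojoin: (E_refl (ojoin (iota 0 n.+1) y)); apply.
    by rewrite mem_iota.
  apply/E_ojoin => k; rewrite mem_iota => kn.
  by move/yP: (E_refl (gen_set n ps)); apply.
split.
  have [C [CE CP]] := big_edeg_join (fun i : 'I_n => cutL ps i.+1).
  have CDG X : E X (oplus C (gen_total n ps)) <-> E X (gen_set n ps).
    rewrite E_oplus CP E_gen_total GE; split=> [[hC [hU h0]]|[hU hL]].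
      by split=> // -[|i] // ni; have := hC (Ordinal ni).
    by split=> [i|]; [exact: hL|split=> //; exact: hL].
  have /CDG/E_oplus[zC zD] := E_zero2_G n Eps.
  exists (edeg C), (edeg (gen_total n ps)); split.
  - apply/n_semirecursiveE; exists (fun i => cutL ps i.+1); split=> // i.
    apply: down_semirecursive => a b ab [s bs]; exists s; exact: rle_trans ab bs.
  - by exists C, zero2_set; split=> //; exact: edeg_refl.
  - split; first by exists (gen_total n ps).
    exists (gen_total n ps); split; [exact: edeg_refl|exact: gen_total_total ps0 psS psG].
  - by exists (gen_total n ps), zero2_set; split=> //; exact: edeg_refl.
  - move=> /n_semirecursiveE[y [ys]].
    have [C' [-> C'P]] := big_edeg_join y.
    rewrite edeg_joinE => /edeg_eqP[h1 h2].
    apply: (not_lub (fun k => y (inord k))) => // X; rewrite -CDG.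
    split=> [XG k kn|h]; first by move/C'P: (E_trans XG h1); apply.
    by apply: E_trans h2; apply/C'P => i; have := h i (ltn_ord i); rewrite inord_val.
have [v vP] := generic_point R ps0 psS psG.
move=> /(_ (edeg (nbase v))) []; first by exists v.
move=> w _ /edeg_eqP[wv vw].
have [y [ys yP]] := nbase_power w.
apply: (not_lub y ys) => X; rewrite -vP -yP.
by split=> h; [exact: E_trans h vw|exact: E_trans h wv].
Qed.
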